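(* Let $(B,+,\circ)$ be a Dedekind skew brace having an ascending series of ideals each of whose factors either is locally finite, or has cyclic additive group, or has cyclic multiplicative group. Then: (1) If $I$ is an ideal of $B$ such that either $(I,+)$ or $(I,\circ)$ is infinite cyclic, then $I\leq Z(B)$. (2) $B$ is hypercentral. In particular, every trivial sub-skew brace $X$ of $B$ such that $(X,+)$ is not periodic is contained in $Z(B)$.
   Context: A skew brace is a triple $(B,+,\circ)$ with $(B,+)$, $(B,\circ)$ (not necessarily abelian) groups such that $a\circ(b+c)=a\circ b-a+a\circ c$ for all $a,b,c\in B$. The identities of the two groups coincide and are denoted by $0$. For $a\in B$ put $\lambda_a(b)=-a+a\circ b$; then $\lambda:a\mapsto\lambda_a$ is a homomorphism $(B,\circ)\to\operatorname{Aut}(B,+)$. A sub-skew brace is a subset that is a subgroup of both $(B,+)$ and $(B,\circ)$. An ideal is a subgroup of $(B,+)$ that is normal in $(B,+)$, invariant under all $\lambda_b$ ($b\in B$), and normal in $(B,\circ)$; one can form the quotient skew brace $B/I$. $B$ is Dedekind if all its sub-skew braces are ideals of $B$. $B$ is trivial if $a+b=a\circ b$ for all $a,b\in B$. A group is periodic if all its elements have finite order. $B$ is locally finite if every finitely generated sub-skew brace is finite. An ascending series of ideals of $B$ is a chain of ideals $\{0\}=I_0\leq I_1\leq\cdots\leq I_\alpha\leq I_{\alpha+1}\leq\cdots\leq I_\mu=B$ of $B$ indexed by the ordinals up to some ordinal $\mu$, with unions taken at limit ordinals; its factors are the skew braces $I_{\alpha+1}/I_\alpha$. The centre of $B$ is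 the ideal $Z(B)=\operatorname{Ker}(\lambda)\cap Z(B,+)\cap Z(B,\circ)$. The upper central series is $Z_0(B)=\{0\}$, $Z_{\alpha+1}(B)/Z_\alpha(B)=Z(B/Z_\alpha(B))$, and $Z_\alpha(B)=\bigcup_{\beta<\alpha}Z_\beta(B)$ for limit ordinals $\alpha$. $B$ is hypercentral if $B=Z_\alpha(B)$ for some ordinal $\alpha$. *)

(* Defs.v *)
From HB Require Import structures.
From mathcomp Require Import all_boot.
From mathcomp Require Import all_classical.
From mathcomp Require wochoice.

Set Implicit Arguments.
Unset Strict Implicit.
Unset Printing Implicit Defensive.

Local Open Scope classical_set_scope.
Local Open Scope quotient_scope.

Section GroupSubsets.
Variable G : groupType.
Implicit Type S : set G.
Local Open Scope group_scope.

Definition subgroup S : Prop :=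
  [/\ S 1, forall x y, S x -> S y -> S (x * y) & forall x, S x -> S x^-1].

Definition normal_subgroup S : Prop :=
  subgroup S /\ forall x y, S x -> S (x ^ y).

Definition group_center : set G := [set x | forall y, commute x y].

Definition cyclic_subgroup S : Prop :=
  exists g, S = [set x | exists n : nat, x = g ^+ n \/ x = g ^- n].

Definition infinite_cyclic S : Prop := cyclic_subgroup S /\ ~ finite_set S.

Definition periodic S : Prop :=
  forall x, S x -> exists2 n : nat, (0 < n)%N & x ^+ n = 1.

Lemma normal_subgroup_cong S x y x' y' : normal_subgroup S ->
  S (x^-1 * x') -> S (y^-1 * y') -> S ((x * y)^-1 * (x' * y')).
Proof.
move=> [[S1 SM SV] SJ] Sx Sy; rewrite invgM.
have -> : y^-1 * x^-1 * (x' * y') = (x^-1 * x') ^ y * (y^-1 * y').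
  by rewrite /conjg !mulgA mulgK.
by apply: SM => //; apply: SJ.
Qed.

Lemma normal_subgroup_congV S x y : normal_subgroup S ->
  S (x^-1 * y) -> S (x^-1^-1 * y^-1).
Proof.
move=> [[S1 SM SV] SJ] Sx; rewrite invgK.
have -> : x * y^-1 = ((x^-1 * y)^-1) ^ x^-1.
  by rewrite /conjg invgM !invgK !mulgA mulgK.
by apply: SJ; apply: SV.
Qed.

Lemma subgroup_equiv S : subgroup S ->
  equiv_class_of (fun x y : G => `[< S (x^-1 * y) >]).
Proof.
move=> [S1 SM SV]; split=> [x|x y|y x z]; first by apply/asboolP; rewrite mulVg.
  by apply: asbool_equiv_eq; split=> /SV; rewrite invgM invgK.
move=> /asboolP Sxy /asboolP Syz; apply/asboolP.
by have := SM _ _ Sxy Syz; rewrite mulgA mulgK.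
Qed.

End GroupSubsets.

Arguments group_center G : clear implicits.

Declare Scope skew_brace_scope.
Delimit Scope skew_brace_scope with sb.

(* The [groupType] structure of the carrier is the circle group. *)
HB.mixin Record Group_isSkewBrace B of Group B := {
  sb_zero : B;
  sb_opp : B -> B;
  sb_add : B -> B -> B;
  sb_addA : associative sb_add;
  sb_add0 : left_id sb_zero sb_add;
  sb_addN : left_inverse sb_zero sb_opp sb_add;
  sb_circD : forall a b c : B,
    (a * sb_add b c)%g = sb_add (sb_add (a * b)%g (sb_opp a)) (a * c)%g
}.

#[short(type="skewBraceType")]
HB.structure Definition SkewBrace := { B of Group_isSkewBrace B & Group B }.

Notation "0" := sb_zero : skew_brace_scope.
Notation "a + b" := (sb_add a b) : skew_brace_scope.
Notation "- a" := (sb_opp a) : skew_brace_scope.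
Notation "a - b" := (sb_add a (sb_opp b)) : skew_brace_scope.
Notation "a '∘' b" := (mul a b)
  (at level 40, left associativity) : skew_brace_scope.

Local Open Scope skew_brace_scope.

(* An alias of the carrier on which the multiplicative [groupType] structure is
   the additive group (B, +): [x * y] in [addg B] is [x + y] in [B]. *)
Definition addg (B : Type) : Type := B.

Section AdditiveGroup.
Variable B : skewBraceType.

Lemma sb_addN' : right_inverse (0 : B) (@sb_opp B) (@sb_add B).
Proof.
move=> x; rewrite -[LHS]sb_add0 -{1}(sb_addN (- x)) -sb_addA.
by rewrite [- x + _]sb_addA sb_addN sb_add0 sb_addN.
Qed.

Lemma sb_add0' : right_id (0 : B) (@sb_add B).
Proof. by move=> x; rewrite -(sb_addN x) sb_addA sb_addN' sb_add0. Qed.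

HB.instance Definition _ := Choice.copy (addg B) B.
HB.instance Definition _ := isGroup.Build (addg B)
  (@sb_addA B) (@sb_add0 B) sb_add0' (@sb_addN B) sb_addN'.

End AdditiveGroup.

Section SkewBraceSubsets.
Variable B : skewBraceType.
Implicit Type S : set B.

Definition lambda (a b : B) : B := - a + a ∘ b.

Lemma sb_circ0 (a : B) : a ∘ 0 = a.
Proof.
have := sb_circD a 0 0; rewrite sb_add0 -[LHS]sb_add0' -sb_addA.
move/(mulgI (a ∘ 0 : addg B)) => E.
have -> : a ∘ 0 = a + (- a + a ∘ 0) by rewrite sb_addA sb_addN' sb_add0.
by rewrite -E; exact: sb_add0'.
Qed.

Lemma sb_one0 : 1%g = 0 :> B.
Proof. by rewrite -[LHS]sb_circ0 mul1g. Qed.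

Lemma sb_circN (a c : B) : a ∘ (- c) = a - a ∘ c + a.
Proof.
have := sb_circD a c (- c); rewrite sb_addN' sb_circ0 -sb_addA => E.
apply: (mulgI (a ∘ c - a : addg B)).
change (a ∘ c - a + a ∘ (- c) = a ∘ c - a + (a - a ∘ c + a)).
rewrite -sb_addA -E -!sb_addA [- a + (a + _)]sb_addA sb_addN sb_add0.
by rewrite sb_addA sb_addN' sb_add0.
Qed.

Lemma lambda_circ (a c b : B) : lambda a (lambda c b) = lambda (a ∘ c) b.
Proof.
rewrite /lambda sb_circD sb_circN mulgA -!sb_addA [- a + (a + _)]sb_addA.
by rewrite sb_addN sb_add0 [a + (- a + _)]sb_addA sb_addN' sb_add0.
Qed.

Lemma lambda1 (b : B) : lambda 1%g b = b.
Proof.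
by rewrite /lambda mul1g sb_one0 -[- 0]sb_add0' sb_addN sb_add0.
Qed.

Definition sub_skew_brace S : Prop :=
  subgroup (S : set (addg B)) /\ subgroup (S : set B).

Definition is_ideal S : Prop :=
  [/\ normal_subgroup (S : set (addg B)),
      forall b x, S x -> S (lambda b x) & normal_subgroup (S : set B)].

Definition trivial_on S : Prop := forall a b, S a -> S b -> a + b = a ∘ b.

Definition finitely_generated S : Prop :=
  exists2 F : set B, finite_set F & S = smallest sub_skew_brace F.

Definition locally_finite S : Prop :=
  forall T, sub_skew_brace T -> T `<=` S -> finitely_generated T ->
    finite_set T.

Definition sb_center : set B :=
  [set a | forall b, lambda a b = b]
  `&` (group_center (addg B) : set B) `&` group_center B.

Definition Dedekind : Prop := forall S, sub_skew_brace S -> is_ideal S.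

End SkewBraceSubsets.

Arguments sb_center B : clear implicits.
Arguments Dedekind B : clear implicits.

Record ideal (B : skewBraceType) :=
  Ideal { ideal_set :> set B; idealP : is_ideal ideal_set }.

Section Quotient.
Variables (B : skewBraceType) (I : ideal B).

Let I_add : normal_subgroup (I : set (addg B)).
Proof. by case: (idealP I). Qed.

Let I_circ : normal_subgroup (I : set B).
Proof. by case: (idealP I). Qed.

Definition coset_rel : rel B := fun x y => `[< ideal_set I (- x + y) >].

Lemma coset_rel_equiv : equiv_class_of coset_rel.
Proof. exact: (subgroup_equiv I_add.1). Qed.

Canonical coset_rel_equiv_rel := EquivRelPack coset_rel_equiv.
Canonical coset_rel_encModRel := defaultEncModRel coset_rel.

Definition quot_brace := {eq_quot coset_rel}.

HB.instance Definition _ : EqQuotient B coset_rel quot_brace :=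
  EqQuotient.on quot_brace.
HB.instance Definition _ := Choice.on quot_brace.

Lemma quot_braceE (x y : B) :
  \pi_quot_brace x = \pi_quot_brace y <-> ideal_set I (- x + y).
Proof.
exact: iff_trans (rwP (eqquotP quot_brace x y)) (iff_sym (rwP (asboolP _))).
Qed.

(* Additive and multiplicative cosets of an ideal coincide. *)
Lemma quot_brace_circE (x y : B) :
  \pi_quot_brace x = \pi_quot_brace y <-> ideal_set I (x^-1%g ∘ y).
Proof.
rewrite quot_braceE.
have Ilam : forall b z, ideal_set I z -> ideal_set I (lambda b z) by case: (idealP I).
have E : lambda x (x^-1%g ∘ y) = - x + y by rewrite /lambda mulgA mulgV mul1g.
split=> [/(Ilam x^-1%g)|/(Ilam x)]; last by rewrite E.
by rewrite -E lambda_circ mulVg lambda1.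
Qed.

Definition quot_zero : quot_brace := lift_cst quot_brace 0.
Definition quot_opp := lift_op1 quot_brace (@sb_opp B).
Definition quot_add := lift_op2 quot_brace (@sb_add B).
Definition quot_one : quot_brace := lift_cst quot_brace 1%g.
Definition quot_inv := lift_op1 quot_brace (fun x : B => x^-1%g).
Definition quot_circ := lift_op2 quot_brace (@mul B).

Canonical pi_zero_morph := PiConst quot_zero.
Canonical pi_one_morph := PiConst quot_one.

Lemma pi_opp : {morph \pi : x / - x >-> quot_opp x}.
Proof.
move=> x; unlock quot_opp; apply/quot_braceE.
apply: (@normal_subgroup_congV (addg B)) => //.
by apply/quot_braceE; rewrite reprK.
Qed.
Canonical pi_opp_morph := PiMorph1 pi_opp.

Lemma pi_add : {morph \pi : x y / x + y >-> quot_add x y}.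
Proof.
move=> x y; unlock quot_add; apply/quot_braceE.
by apply: (@normal_subgroup_cong (addg B)) => //;
  apply/quot_braceE; rewrite reprK.
Qed.
Canonical pi_add_morph := PiMorph2 pi_add.

Lemma pi_inv : {morph \pi : x / x^-1%g >-> quot_inv x}.
Proof.
move=> x; unlock quot_inv; apply/quot_brace_circE.
apply: normal_subgroup_congV => //.
by apply/quot_brace_circE; rewrite reprK.
Qed.
Canonical pi_inv_morph := PiMorph1 pi_inv.

Lemma pi_circ : {morph \pi : x y / x ∘ y >-> quot_circ x y}.
Proof.
move=> x y; unlock quot_circ; apply/quot_brace_circE.
by apply: normal_subgroup_cong => //;
  apply/quot_brace_circE; rewrite reprK.
Qed.
Canonical pi_circ_morph := PiMorph2 pi_circ.

Lemma quot_addA : associative quot_add.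
Proof.
by move=> x y z; rewrite -[x]reprK -[y]reprK -[z]reprK !piE sb_addA.
Qed.

Lemma quot_add0 : left_id quot_zero quot_add.
Proof. by move=> x; rewrite -[x]reprK !piE sb_add0. Qed.

Lemma quot_addN : left_inverse quot_zero quot_opp quot_add.
Proof. by move=> x; rewrite -[x]reprK !piE sb_addN. Qed.

Lemma quot_circA : associative quot_circ.
Proof.
by move=> x y z; rewrite -[x]reprK -[y]reprK -[z]reprK !piE mulgA.
Qed.

Lemma quot_circ1g : left_id quot_one quot_circ.
Proof. by move=> x; rewrite -[x]reprK !piE mul1g. Qed.

Lemma quot_circg1 : right_id quot_one quot_circ.
Proof. by move=> x; rewrite -[x]reprK !piE mulg1. Qed.

Lemma quot_circVg : left_inverse quot_one quot_inv quot_circ.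
Proof. by move=> x; rewrite -[x]reprK !piE mulVg. Qed.

Lemma quot_circgV : right_inverse quot_one quot_inv quot_circ.
Proof. by move=> x; rewrite -[x]reprK !piE mulgV. Qed.

Lemma quot_circD (a b c : quot_brace) :
  quot_circ a (quot_add b c) =
  quot_add (quot_add (quot_circ a b) (quot_opp a)) (quot_circ a c).
Proof. by rewrite -[a]reprK -[b]reprK -[c]reprK !piE sb_circD. Qed.

HB.instance Definition _ := isGroup.Build quot_brace
  quot_circA quot_circ1g quot_circg1 quot_circVg quot_circgV.
HB.instance Definition _ := Group_isSkewBrace.Build quot_brace
  quot_addA quot_add0 quot_addN quot_circD.

End Quotient.

(* J / I for ideals I <= J, as a sub-skew brace of B / I. *)
Definition ideal_factor (B : skewBraceType) (J I : ideal B) :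
    set (quot_brace I) :=
  \pi_(quot_brace I) @` J.

Arguments ideal_factor {B} J I _.

(* The ordinals up to some bound are modelled by a well-ordered type A, where
   [R a b] stands for a <= b. *)
Section Series.
Variables (A : Type) (R : rel A) (B : skewBraceType).

Definition idx_lt (a b : A) : Prop := R a b /\ a <> b.

Definition idx_zero (a : A) : Prop := forall b, R a b.

Definition idx_succ (a b : A) : Prop :=
  idx_lt a b /\ forall c, idx_lt a c -> R b c.

Definition idx_limit (a : A) : Prop :=
  ~ idx_zero a /\ forall b, ~ idx_succ b a.

Record ideal_chain (I : A -> ideal B) : Prop := IdealChain {
  chain_wo : wochoice.well_order R;
  chain_le : forall a b, R a b -> I a `<=` I b;
  chain_zero : forall a, idx_zero a -> I a = [set 0] :> set B;
  chain_limit : forall a, idx_limit a ->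
    I a = \bigcup_(b in [set b | idx_lt b a]) (I b) :> set B
}.

(* The index [m] plays the role of the last ordinal mu. *)
Definition ascending_series (I : A -> ideal B) : Prop :=
  ideal_chain I /\ exists2 m, (forall a, R a m) & I m = setT :> set B.

Definition upper_central_series (Z : A -> ideal B) : Prop :=
  ideal_chain Z /\
  forall a b, idx_succ a b ->
    ideal_factor (Z b) (Z a) = sb_center (quot_brace (Z a)).

End Series.

Definition hypercentral (B : skewBraceType) : Prop :=
  exists (A : Type) (R : rel A) (Z : A -> ideal B),
    upper_central_series R Z /\ exists a, Z a = setT :> set B.

(* Main.v *)
Require Import Defs.
From HB Require Import structures.
From mathcomp Require Import all_boot all_order all_algebra all_fingroup all_solvable.
From mathcomp Require Import all_classical finmap.
From mathcomp Require Import zify.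

Import GRing.Theory Num.Theory.

Set Implicit Arguments.
Unset Strict Implicit.
Unset Printing Implicit Defensive.

(** Throughout, [B] is a Dedekind skew brace, [self_fixed c] says that
    [lambda c c = c], and [cyc c] is the cyclic subgroup generated by [c].  For a
    self-fixed [c] the additive and the multiplicative subgroups generated by
    [c] coincide and form a trivial sub-skew brace, hence an ideal.

    The series enters only through [tame_quotients]: each nonzero image of [B]
    has a nonzero element that is self-fixed or lies in a finite sub-skew brace.
    Indeed the least term of the series outside the kernel has as its image a
    nonzero quotient of a factor.  If that image is infinite cyclic, a self-fixed
    element must be found in it.  For an infinite cyclic additive group this is a
    matter of signs [add_infinite_cyclic_fixed].  For an infinite cyclic
    multiplicative group, Ito's argument on products of abelian groups [ito]
    reduces the question to a commutative addition, where
    [regular_affine_fix] applies: if an affine map [v |-> a + phi v] of an abelian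
    group generates a regular infinite cyclic group, then [phi a = a].

    The heart is [prime_order_central]: a self-fixed [c] of prime order [p] is
    central.  After division by an ideal that is maximal among those avoiding
    [c], every nonzero sub-skew brace contains [c].  Then every element lies in a
    finite sub-skew brace: otherwise, modulo the ideal of elements that do, there
    would be a self-fixed element, and a power of one of its preimages would
    generate an infinite trivial sub-skew brace, torsion-free and so without [c].
    By Cauchy's theorem for finite skew braces [finite_sub_Cauchy] a finite
    sub-skew brace has a self-fixed element of order [q] for each prime [q]
    dividing its order; here [c] must be a power of it, so [q = p].  Hence each
    [b] acts on the group of order [p] generated by [c] with order a power of
    [p], that is, trivially.

    If [J] is an ideal with infinite cyclic addition, the previous result applied
    modulo [3 J] shows that [B] does not invert [J], hence acts trivially on it.
    If [J] has infinite cyclic multiplication, it contains a self-fixed element,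
    which is central by the additive case.  If [J] were not contained in [Z(B)],
    an element of prime order of [J] modulo the intersection of [J] and [Z(B)]
    would be moved by central elements of finite order, but [J] has none except
    zero.  In a trivial sub-skew brace the elements of infinite order generate
    infinite cyclic ideals, and the others are differences of such elements.

    It follows that the centre of [B] is nonzero if [B] is, and the same holds
    for the quotients of [B], so that the upper central series indexed by a
    well-ordering of the power set of [B] must reach [B]. *)

(** * Cauchy's theorem for bijective cocycles *)

Section CocycleCauchy.
Import GroupScope.
(* A finite skew brace with its two groups told apart: [i] is the identity map
   from the multiplicative to the additive group, and [l] is [lambda]. *)
Variables (cT aT : finGroupType) (i : cT -> aT) (j : aT -> cT).
Variable l : cT -> aT -> aT.
Hypotheses (iK : cancel i j) (jK : cancel j i).
Hypothesis lM : forall c, {morph l c : x y / x * y}.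
Hypothesis lA : forall c d x, l c (l d x) = l (c * d) x.
Hypothesis l1 : forall x, l 1 x = x.
Hypothesis iM : forall c d, i (c * d) = i c * l c (i d).

Let lK c : cancel (l c) (l c^-1).
Proof. by move=> x; rewrite lA mulVg l1. Qed.

Let lc1 c : l c 1 = 1.
Proof. by apply: (mulgI (l c 1)); rewrite -lM !mulg1. Qed.

Let lX c x n : l c (x ^+ n) = l c x ^+ n.
Proof. by elim: n => [|n IH]; rewrite ?lc1 // !expgS lM IH. Qed.

Let i1 : i 1 = 1.
Proof. by apply: (mulgI (i 1)); rewrite -{2}[i 1]l1 -iM !mulg1. Qed.

Let lam x c := l c^-1 x.
Let lam_is_action : is_action [set: cT] lam.
Proof.
split=> [c x y|x c d _ _]; last by rewrite /lam lA invMg.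
exact: (can_inj (lK _)).
Qed.
Let lamA := Action lam_is_action.

Let tr x c := i (c^-1 * j x).
Let tr_is_action : is_action [set: cT] tr.
Proof.
split=> [c x y|x c d _ _]; last by rewrite /tr iK invMg mulgA.
by move/(can_inj iK)/mulgI/(can_inj jK).
Qed.
Let trA := Action tr_is_action.

(** The number of Sylow subgroups is [1] modulo [p], so that a [p]-group which
    permutes them fixes one. *)
Lemma cocycle_fixed_Sylow (p : nat) (P : {group cT}) : prime p -> p.-group P ->
  exists Q : {group aT}, p.-Sylow([set: aT]) Q /\
    forall c x, c \in P -> x \in Q -> l c x \in Q.
Proof.
move=> pr_p pP; pose O := [set gval Q | Q in 'Syl_p([set: aT])].
have Oacts : [acts P, on O | lamA^*].
  apply/fintype.subsetP => c Pc; rewrite !inE /=.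
  apply/fintype.subsetP => _ /imsetP[Q SylQ ->].
  rewrite inE /=; rewrite inE in SylQ.
  have gQ : group_set (lam^~ c @: Q).
    apply/group_setP; split.
      by apply/imsetP; exists 1; rewrite // /lam lc1.
    move=> _ _ /imsetP[x Qx ->] /imsetP[y Qy ->].
    by apply/imsetP; exists (x * y); rewrite ?groupM // /lam lM.
  apply/imsetP; exists (Group gQ) => //.
  rewrite inE pHallE finset.subsetT /= card_imset; last exact: can_inj (lK _).
  by move: SylQ; rewrite pHallE => /andP[].
have := pgroup_fix_mod pP Oacts.
rewrite card_imset; last exact: val_inj.
rewrite card_Syl_mod // => /esym E.
have [/eqP F0|/finset.set0Pn [Q0]] := boolP ('Fix_(O | lamA^*)(P) == finset.set0).
  by move: E; rewrite F0 cards0 mod0n.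
rewrite inE => /andP[/imsetP[Q SylQ ->] /afixP fixQ].
exists Q; split; first by move: SylQ; rewrite inE.
move=> c x Pc Qx; rewrite -[gval Q](fixQ c^-1) ?groupV //=.
by apply/imsetP; exists x; rewrite // /= /lam invgK.
Qed.

(** Cauchy's theorem for finite skew braces, in the language of bijective
    cocycles.  A Sylow subgroup [P] of the source stabilises a Sylow subgroup
    [Q] of the target, hence permutes the cosets of [Q]; their number is prime
    to [p], so that it fixes one of them, which makes a conjugate of [P] and the
    image of [Q] under some [l c] correspond to each other. *)
Lemma cocycle_Cauchy (p : nat) : prime p -> p %| #|cT| ->
  exists c, [/\ c != 1, c ^+ p = 1 & l c (i c) = i c].
Proof.
move=> pr_p p_dvd; have [P SylP] := Sylow_exists p [set: cT].
have pP := pHall_pgroup SylP.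
have [Q [SylQ lQ]] := cocycle_fixed_Sylow pr_p pP.
have ac : #|cT| = #|aT| by exact: bij_eq_card (Bijective iK jK).
have cPQ : #|P| = #|Q|.
  by rewrite (card_Hall SylP) (card_Hall SylQ) !cardsT ac.
pose O := lcosets Q [set: aT].
have Oacts : [acts P, on O | trA^*].
  apply/fintype.subsetP => c Pc; rewrite !inE /=; apply/fintype.subsetP => X.
  rewrite inE /= => /lcosetsP[x _ ->]; apply/lcosetsP.
  exists (i (c^-1 * j x)); rewrite ?inE //.
  have sub : tr^~ c @: (x *: Q) \subset i (c^-1 * j x) *: Q.
    apply/fintype.subsetP => _ /imsetP[_ /lcosetP[q Qq ->] ->].
    rewrite /tr iM jK lM mulgA mem_lcoset iM jK mulKg.
    by apply: lQ; rewrite ?groupV.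
  apply/eqP; rewrite eqEcard sub /= card_lcoset card_imset ?card_lcoset //.
  by move=> y z /(can_inj iK)/mulgI/(can_inj jK).
have := pgroup_fix_mod pP Oacts.
have nO : ~~ (p %| #|O|).
  have := SylQ; rewrite pHallE => /andP[_ /eqP cQ].
  rewrite card_lcosets -divgS ?finset.subsetT // cQ -p'natE //.
  rewrite -[X in X %/ _](partnC p) ?cardG_gt0 // mulKn ?part_gt0 //.
  exact: part_pnat.
move=> E; have [/eqP F0|/finset.set0Pn [X]] :=
    boolP ('Fix_(O | trA^*)(P) == finset.set0).
  by move: nO; rewrite /dvdn E F0 cards0 mod0n.
rewrite inE => /andP[/lcosetsP[x _ ->] /afixP fixX].
pose y := j x.
have cyQ c : c \in P -> exists2 q, q \in Q & i (c * y) = x * q.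
  move=> Pc; have : i (c * y) \in x *: Q.
    rewrite -(fixX c^-1) ?groupV //=; apply/imsetP; exists x.
      by rewrite mem_lcoset mulVg.
    by rewrite /= /tr invgK.
  by move/lcosetP=> [q Qq ->]; exists q.
(* The fixed coset [x * Q] is the image of [P * y], so that [y^-1 * P * y]
   corresponds to [l y^-1 @: Q]; it is a sub-skew brace of order a power of [p],
   on whose additive group it acts with a nontrivial fixed point. *)
pose K := (P :^ y)%G.
pose M := l y^-1 @: Q.
have sKM : i @: K \subset M.
  apply/fintype.subsetP => _ /imsetP[_ /imsetP[c Pc ->] ->].
  have [q Qq Eq] := cyQ c Pc; apply/imsetP; exists q => //.
  have xE : x = i y by rewrite /y jK.
  by rewrite conjgE iM Eq lM mulgA {1}xE -iM mulVg i1 mul1g.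
have KM : i @: K = M.
  apply/eqP; rewrite eqEcard sKM /= (card_imset _ (can_inj iK)).
  by rewrite (card_imset _ (can_inj (lK _))) cardJg cPQ leqnn.
have lamM : [acts K, on M | lamA].
  apply/fintype.subsetP => k; rewrite -groupV => /imsetP[c Pc Ek].
  rewrite !inE /=; apply/fintype.subsetP => _ /imsetP[q Qq ->].
  rewrite inE /= /lam Ek.
  apply/imsetP; exists (l c q); first exact: lQ.
  by rewrite !lA conjgE -!mulgA mulgV mulg1.
have pK : p.-group K by rewrite /pgroup /K /= cardJg.
have := pgroup_fix_mod pK lamM.
have pKd : p %| #|M|.
  rewrite -KM card_imset; last exact: can_inj iK.
  rewrite /K /= cardJg (card_Hall SylP) cardsT.
  rewrite p_part -{1}(expn1 p) dvdn_exp2l // logn_gt0 mem_primes pr_p p_dvd.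
  by rewrite andbT; apply/card_gt0P; exists 1.
pose F := 'Fix_(M | lamA)(K); move/eqP; rewrite -/F => cMF.
have F1 : 1 \in F.
  rewrite inE; apply/andP; split; last by apply/afixP => k _; apply: lc1.
  by apply/imsetP; exists 1; rewrite ?lc1.
have /fintype.subsetPn [m Fm m1] : ~~ (F \subset [1 aT]).
  apply/negP => /subset_leq_card; rewrite cards1 => F_le1.
  have : p %| #|F| by rewrite /dvdn -(eqP cMF).
  have : 0 < #|F| by apply/card_gt0P; exists 1.
  move=> F_gt0; have -> : #|F| = 1%N by apply/eqP; rewrite eqn_leq F_le1.
  by rewrite dvdn1; apply/negP; rewrite neq_ltn prime_gt1 ?orbT.
have [k Kk mE] : exists2 k, k \in K & m = i k.
  move: Fm; rewrite inE => /andP[]; rewrite -KM => /imsetP[k Kk ->] _.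
  by exists k.
have lkm : l k m = m.
  move: Fm; rewrite inE => /andP[_ /afixP/(_ k^-1)].
  by rewrite groupV /= /lam invgK; apply.
have lkXm n : l (k ^+ n) m = m.
  by elim: n => [|n IH]; rewrite ?expg0 ?l1 // expgS -lA IH.
have ikX n : i (k ^+ n) = m ^+ n.
  elim: n => [|n IH]; first by rewrite !expg0 i1.
  by rewrite !expgS iM IH lX lkm -mE.
have k1 : k != 1.
  by apply: contraNneq m1 => k1; rewrite mE k1 i1 inE.
have p_dvd_k : p %| #[k].
  have /p_natP [[|n]] := mem_p_elt pK Kk.
    by rewrite expn0 => /eqP; rewrite order_eq1 (negPf k1).
  by move=> ->; rewrite expnS dvdn_mulr.
(* A power of a self-fixed element is self-fixed. *)
exists (k ^+ (#[k] %/ p)); split.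
- apply/eqP => /eqP; rewrite -order_dvdn => /dvdn_leq.
  rewrite divn_gt0 ?prime_gt0 // dvdn_leq // => /(_ isT).
  by rewrite leqNgt ltn_Pdiv // prime_gt1.
- by rewrite -expgM divnK // expg_order.
- by rewrite ikX lX lkXm.
Qed.
End CocycleCauchy.

Local Open Scope classical_set_scope.
Local Open Scope group_scope.
Local Open Scope skew_brace_scope.
Local Open Scope quotient_scope.

(** * Integer powers in a group *)

Section IntegerPowers.
Variable G : groupType.
Implicit Types (x y : G) (m n : int) (S : set G).

Definition zexp x n : G :=
  match n with Posz k => x ^+ k | Negz k => x ^- k.+1 end.

Definition cyc x : set G := range (zexp x).

Lemma zexp_nat x (k : nat) : zexp x k = x ^+ k. Proof. by []. Qed.

Lemma zexp1 x : zexp x 1 = x. Proof. exact: expg1. Qed.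

Lemma zexp_opp_nat x (k : nat) : zexp x (- k%:Z)%R = x ^- k.
Proof. by case: k => [|k] //=; rewrite ?invg1 -?NegzE. Qed.

Lemma zexpS x n : zexp x (n + 1)%R = zexp x n * x.
Proof.
case: n => k; first by rewrite /= addn1 expgSr.
have -> : (Negz k + 1 = - k%:Z)%R by lia.
by rewrite zexp_opp_nat /= expgS invgM mulgVK.
Qed.

Lemma zexpB1 x n : zexp x (n - 1)%R = zexp x n * x^-1.
Proof. by rewrite -{2}(subrK 1%R n) zexpS mulgK. Qed.

Lemma int_ind2 (P : int -> Prop) : P 0%R -> (forall n, P n -> P (n + 1)%R) ->
  (forall n, P n -> P (n - 1)%R) -> forall n, P n.
Proof.
move=> P0 PS PP; elim=> [//|n|n] /=; first by rewrite -addn1 PoszD; apply: PS.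
by rewrite -addn1 PoszD opprD; apply: PP.
Qed.

Lemma zexpD x m n : zexp x (m + n)%R = zexp x m * zexp x n.
Proof.
elim/int_ind2: n => [|n IH|n IH]; first by rewrite addr0 mulg1.
  by rewrite addrA !zexpS IH mulgA.
by rewrite addrA !zexpB1 IH mulgA.
Qed.

Lemma zexpN x n : zexp x (- n)%R = (zexp x n)^-1.
Proof. by apply/esym/mulg1_eq; rewrite -zexpD subrr. Qed.

Lemma zexpM x m n : zexp x (m * n)%R = zexp (zexp x m) n.
Proof.
elim/int_ind2: n => [|n IH|n IH]; first by rewrite mulr0.
  by rewrite mulrDr mulr1 zexpS -IH -zexpD.
by rewrite mulrBr mulr1 zexpB1 -IH -zexpN -zexpD.
Qed.

Lemma zexp1n n : zexp (1 : G) n = 1.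
Proof. by case: n => k /=; rewrite expg1n ?invg1. Qed.

Lemma subgroup_zexp S x n : subgroup S -> S x -> S (zexp x n).
Proof.
move=> [S1 SM SV] Sx; elim/int_ind2: n => [//|n IH|n IH].
  by rewrite zexpS; apply: SM.
by rewrite zexpB1; apply: SM => //; apply: SV.
Qed.

Lemma cyc_subgroup x : subgroup (cyc x).
Proof.
split; first by exists 0%R.
  by move=> _ _ [m _ <-] [n _ <-]; exists (m + n)%R; rewrite // zexpD.
by move=> _ [m _ <-]; exists (- m)%R; rewrite // zexpN.
Qed.

Lemma cyc_id x : cyc x x.
Proof. by exists 1%R; rewrite ?zexp1. Qed.

Lemma cyc_sub S x : subgroup S -> S x -> cyc x `<=` S.
Proof. by move=> Ssub Sx _ [n _ <-]; apply: subgroup_zexp. Qed.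

Lemma cyclic_subgroupP S : cyclic_subgroup S <-> exists g, S = cyc g.
Proof.
split=> -[g ->]; exists g; apply/seteqP; split=> x /=.
- by move=> [k [] ->]; [exists k | exists (- k%:Z)%R]; rewrite ?zexp_opp_nat.
- move=> [[k|k] _ <-]; first by exists k; left.
  by exists k.+1; right.
- by move=> [[k|k] _ <-]; [exists k; left | exists k.+1; right].
- by move=> [k [] ->]; [exists k | exists (- k%:Z)%R]; rewrite ?zexp_opp_nat.
Qed.

Definition torsion x := exists2 k : nat, (0 < k)%N & x ^+ k = 1.

Lemma zexp_torsion x n : n <> 0%R -> zexp x n = 1 -> torsion x.
Proof.
case: n => [[|k]|k] // _ /= E; first by exists k.+1.
by exists k.+1 => //; apply: invg_inj; rewrite invg1.
Qed.

Lemma zexp_inj x : ~ torsion x -> injective (zexp x).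
Proof.
move=> xoo m n E; apply/eqP; rewrite -subr_eq0; apply/eqP.
apply: contrapT => ne0; apply: xoo; apply: (zexp_torsion ne0).
by rewrite zexpD zexpN E mulgV.
Qed.

Lemma cyc_finite x : torsion x -> finite_set (cyc x).
Proof.
move=> [k k0 xk].
apply: (@sub_finite_set _ _ ((fun i : nat => x ^+ i) @` `I_k)); last first.
  by apply: finite_image; apply: finite_II.
move=> _ [n _ <-]; exists `|(n %% k)%Z|%N => /=.
  have := @ltz_mod n k; lia.
have -> : x ^+ `|(n %% k)%Z| = zexp x (n %% k)%Z.
  by rewrite -zexp_nat gez0_abs // modz_ge0 //; lia.
rewrite [in RHS](divz_eq n k) [in RHS]zexpD mulrC zexpM zexp_nat xk zexp1n.
by rewrite mul1g.
Qed.

Lemma torsion_sub_cyc x y : cyc x y -> y <> 1 -> torsion y -> torsion x.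
Proof.
move=> [n _ <-] ne1 [k k0 E]; apply: (@zexp_torsion x (n * k)%R); last first.
  by rewrite zexpM.
move/eqP; rewrite mulf_eq0 => /orP[/eqP n0|/eqP]; last lia.
by apply: ne1; rewrite n0.
Qed.

End IntegerPowers.

Lemma zexp_morph (G H : groupType) (f : G -> H) x n :
  {morph f : x y / x * y} -> f (zexp x n) = zexp (f x) n.
Proof.
move=> fM; have f1 : f 1 = 1 by apply: (mulgI (f 1)); rewrite -fM !mulg1.
have fV y : f y^-1 = (f y)^-1 by apply/esym/mulg1_eq; rewrite -fM mulgV.
elim/int_ind2: n => [//|n IH|n IH]; first by rewrite !zexpS fM IH.
by rewrite !zexpB1 fM fV IH.
Qed.

Lemma finite_repeat (T : choiceType) (F : set T) (f : nat -> T) :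
  finite_set F -> (forall i, F (f i)) -> exists i j, (i < j)%N /\ f i = f j.
Proof.
move=> finF Ff; apply: contrapT => H; apply: infinite_nat.
have inj : {in setT &, injective f}.
  move=> i j _ _ E; apply/eqP; case: ltngtP => // ltij; case: H.
    by exists i, j.
  by exists j, i.
apply: sub_finite_set (finite_preimage (sub_in2 (fun _ _ => mem_setT _) inj) finF).
by move=> k _; apply: Ff.
Qed.

Lemma sg1 (G : groupType) (S : set G) : subgroup S -> S 1.
Proof. by case. Qed.

Lemma subgroup_cyc (G : groupType) (S : set G) (x : G) :
  subgroup S -> S `<=` cyc x -> exists m : nat, S = cyc (x ^+ m).
Proof.
move=> Ss Sx.
have pos n : n <> 0%R -> S (zexp x n) ->
    exists2 k : nat, (0 < k)%N & S (x ^+ k).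
  case: n => [[|k]|k] // _ Sn; first by exists k.+1.
  by exists k.+1 => //; have := subgroup_zexp (-1) Ss Sn; rewrite /= expg1 invgK.
have [ex|nex] := pselect (exists k : nat, [&& (0 < k)%N & `[< S (x ^+ k) >]]).
  case: (ex_minnP ex) => m /andP[m0 /asboolP Sm] m_min; exists m.
  apply/seteqP; split; last exact: cyc_sub.
  move=> y Sy; have [n _ yE] := Sx y Sy.
  have rE : zexp x (n %% m)%Z = y * zexp (x ^+ m) (- (n %/ m)%Z)%R.
    rewrite -yE -zexp_nat -zexpM -zexpD; congr (zexp x _).
    by have := divz_eq n m; lia.
  have Sr : S (zexp x (n %% m)%Z).
    by rewrite rE; case: (Ss) => _ SM _; apply: SM => //; apply: subgroup_zexp.
  have [r0|rn0] := eqVneq (n %% m)%Z 0%R.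
    exists (n %/ m)%Z => //.
    rewrite -zexp_nat -zexpM -yE; congr (zexp x _).
    by have := divz_eq n m; lia.
  exfalso; have := @ltz_mod n m; have := @modz_ge0 n m.
  move: Sr rn0; case: (n %% m)%Z => [r|r] //= Sr rn0 ge0 ltrm; last by lia.
  by have := m_min r; rewrite lt0n rn0 /=; move/(_ (asboolT Sr)); lia.
exists 0%N; apply/seteqP; split; last exact: cyc_sub (sg1 Ss).
move=> y Sy; have [n _ yE] := Sx y Sy.
have [n0|n0] := eqVneq n 0%R; first by rewrite -yE n0; apply: cyc_id.
have [k k0 Sk] : exists2 k : nat, (0 < k)%N & S (x ^+ k).
  by apply: (pos n); [apply/eqP | rewrite yE].
by case: nex; exists k; rewrite k0 /=; apply/asboolP.
Qed.

(** * Infinite cyclic groups of affine maps *)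

Section RegularAffine.
Local Open Scope ring_scope.
(* The affine map [v |-> a + phi v] acts regularly on [V], and [s n] is the image
   of [0] under its [n]-th power. *)
Variables (V : zmodType) (phi psi : V -> V) (a : V) (s : int -> V).
Hypotheses (phiD : {morph phi : x y / x + y}) (phiK : cancel phi psi)
  (psiK : cancel psi phi).
Hypotheses (s0 : s 0 = 0) (sS : forall n, s (n + 1) = a + phi (s n)).
Hypotheses (s_inj : injective s) (s_surj : forall v, exists n, v = s n).

Let psiD : {morph psi : x y / x + y}.
Proof. by move=> x y; apply: (can_inj phiK); rewrite phiD !psiK. Qed.

Let morphZ (f : V -> V) : {morph f : x y / x + y} ->
  forall x n, f (x *~ n) = f x *~ n.
Proof.
move=> fD x n; have f0 : f 0 = 0 by apply: (addrI (f 0)); rewrite -fD !addr0.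
have fN y : f (- y) = - f y by apply: (addrI (f y)); rewrite -fD !subrr.
elim/int_ind2: n => [|n IH|n IH]; rewrite ?mulr0z //.
  by rewrite !mulrzDr fD IH.
by rewrite !mulrzBr fD fN IH.
Qed.

Let morphS (f : V -> V) : {morph f : x y / x + y} ->
  forall n (F : 'I_n -> V), f (\sum_i F i) = \sum_i f (F i).
Proof.
move=> fD n F; apply: (big_morph f fD).
by apply: (addrI (f 0)); rewrite -fD !addr0.
Qed.

Let phiB x y : phi (x - y) = phi x - phi y.
Proof. by have := morphZ phiD y (-1); rewrite phiD !mulrN1z => ->. Qed.

(* [d n] is the image of [a] under the [n]-th power of [phi].  It is kept
   abstract so that rewriting in sums does not unfold it. *)
Variable d : int -> V.
Hypothesis dE : forall n, d n = s (n + 1) - s n.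

Let d0 : d 0 = a.
Proof.
by rewrite dE sS s0 -[phi 0]/(phi (0 *~ 0)) (morphZ phiD) mulr0z addr0 subr0.
Qed.

Let phi_d n : phi (d n) = d (n + 1).
Proof. by rewrite !dE phiB [s (n + 1 + 1)]sS sS opprD addrACA subrr add0r. Qed.

Let psi_d n : psi (d n) = d (n - 1).
Proof. by apply: (can_inj phiK); rewrite psiK phi_d subrK. Qed.

Let stable_d (P : V -> Prop) : (forall v, P v -> P (phi v)) ->
  (forall v, P v -> P (psi v)) -> forall m, P (d m) -> forall n, P (d n).
Proof.
move=> Pphi Ppsi m Pm n; rewrite -(subrK m n) addrC.
elim/int_ind2: (n - m) => [|k IH|k IH]; first by rewrite addr0.
  by rewrite addrA -phi_d; apply: Pphi.
by rewrite addrA -psi_d; apply: Ppsi.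
Qed.

(** The differences [d n] span, so that an additive property that they share
    holds everywhere. *)
Let span_d (P : V -> Prop) : P 0 -> (forall v w, P v -> P w -> P (v + w)) ->
  (forall v, P v -> P (- v)) -> (forall n, P (d n)) -> forall v, P v.
Proof.
move=> P0 PD PN Pd v; have [n ->] := s_surj v.
elim/int_ind2: n => [|n IH|n IH]; first by rewrite s0.
  by rewrite -(subrK (s n) (s (n + 1))) -dE; apply: PD.
have -> : s (n - 1) = s n - d (n - 1) by rewrite dE subrK opprB [RHS]addrC subrK.
by apply: PD => //; apply: PN.
Qed.

Let s_sum (m : int) (n : nat) : s (m + n) = s m + \sum_(i < n) d (m + i).
Proof.
elim: n => [|n IH]; first by rewrite big_ord0 !addr0.
rewrite big_ord_recr /= addrA -IH -addn1 PoszD addrA dE.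
by rewrite [RHS]addrC subrK.
Qed.

Let shift_sum (c : nat -> int) (n : nat) (m m' : int) :
  \sum_(i < n) d (m + i) *~ c i = 0 -> \sum_(i < n) d (m' + i) *~ c i = 0.
Proof.
move=> E; rewrite -(subrK m m') addrC; elim/int_ind2: (m' - m) => [|k IH|k IH].
- by rewrite addr0.
- have phi0 : phi 0 = 0 by rewrite -(mulr0z a) (morphZ phiD) mulr0z.
  apply: etrans (etrans (congr1 phi IH) phi0); rewrite (morphS phiD).
  apply: eq_bigr => i _.
  by rewrite (morphZ phiD) phi_d; congr (d _ *~ _); lia.
- have psi0 : psi 0 = 0 by rewrite -(mulr0z a) (morphZ psiD) mulr0z.
  apply: etrans (etrans (congr1 psi IH) psi0); rewrite (morphS psiD).
  apply: eq_bigr => i _.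
  by rewrite (morphZ psiD) psi_d; congr (d _ *~ _); lia.
Qed.

(** Writing [d 0 + d 2] as a value of [s] gives a linear relation between
    finitely many consecutive [d i] whose extreme coefficients are [1]. *)
Let relation : phi a = a \/ exists (N : nat) (c : nat -> int) (m : int),
  [/\ (0 < N)%N, c 0%N = 1, c N = 1 & \sum_(i < N.+1) d (m + i) *~ c i = 0].
Proof.
have aP : a = 0 -> phi a = a.
  by move=> ->; rewrite -(mulr0z a) (morphZ phiD) mulr0z.
have da n : d n = 0 -> a = 0.
  move=> dn; rewrite -d0; apply: (stable_d (P := fun v => v = 0) _ _ dn) => v ->.
    by rewrite -(mulr0z a) (morphZ phiD) mulr0z.
  by rewrite -(mulr0z a) (morphZ psiD) mulr0z.
have [j jE] := s_surj (d 0 + d 2).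
have [j4|j4] := lerP 4 j.
  have [n nE] : exists n : nat, j = n%:Z + 4 by exists `|j - 4|%N; lia.
  right; exists n.+2, (fun i => (i != 1)%:Z), 1; split=> //.
  rewrite 2!big_ord_recl /= mulr0z mulr1z add0r.
  apply: (addrI (d 0)); apply: (addIr (d 2)); rewrite !addr0 jE.
  have -> : j = 1 + n.+3%:Z by lia.
  rewrite s_sum [X in _ = _ + X]big_ord_recl [X in _ = _ + (_ + X)]big_ord_recl /=.
  have <- : d 0 = s 1 by rewrite dE s0 subr0.
  rewrite -!addrA; congr (_ + (_ + _)); by rewrite addrC; congr (_ + _).
have [j0|j0] := lerP j 0.
  have [n nE] : exists n : nat, j = - n%:Z by exists `|j|%N; lia.
  right; exists n.+2, (fun i => (i != n.+1)%:Z), j; split=> //.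
    by rewrite neq_ltn leqnn orbT.
  rewrite 3!big_ord_recr /= eqxx mulr0z addr0.
  rewrite [n.+2 == _]gtn_eqF // [n == _]ltn_eqF //= !mulr1z.
  have -> : j + n = 0 by lia.
  have -> : j + n.+2 = 2 by lia.
  rewrite -addrA jE nE.
  have := s_sum (- n%:Z) n; rewrite addNr s0 => E.
  rewrite [RHS]E addrC; congr (_ + _); apply: eq_bigr => i _.
  by rewrite ltn_eqF ?mulr1z // ltnS ltnW.
left; have [j1|[j2|j3]] : j = 1 \/ j = 2 \/ j = 3 by lia.
- by apply/aP/(da 2)/(addrI (d 0)); rewrite jE j1 addr0 dE s0 subr0.
- have d21 : d 2 = d 1.
    apply: (addrI (d 0)); rewrite jE j2 !dE s0 subr0 [RHS]addrC.
    by rewrite subrK.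
  by rewrite -d0 phi_d; apply: (can_inj phiK); rewrite !phi_d.
- apply/aP/(da 1)/(addrI (d 0))/(addIr (d 2)); rewrite addr0 jE j3 !dE s0 subr0.
  by rewrite [s 1 + _]addrC subrK [LHS]addrC subrK.
Qed.

(** Since both extreme coefficients are [1], the relation can be solved for its
    first and for its last term, so that [N] consecutive differences span a
    subgroup stable under [phi] and its inverse. *)
Let module_span (N : nat) (c : nat -> int) (m : int) :
    (0 < N)%N -> c 0%N = 1 -> c N = 1 ->
    \sum_(i < N.+1) d (m + i) *~ c i = 0 ->
  forall v, exists b : 'I_N -> int, v = \sum_(i < N) d i *~ b i.
Proof.
move=> N0 c0 cN /(@shift_sum c N.+1 m) rel.
pose P v := exists b : 'I_N -> int, v = \sum_(i < N) d i *~ b i.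
have PD v w : P v -> P w -> P (v + w).
  move=> [b ->] [b' ->]; exists (fun i => b i + b' i).
  by rewrite -big_split; apply: eq_bigr => i _; rewrite mulrzDr.
have PZ v n : P v -> P (v *~ n).
  move=> [b ->]; exists (fun i => b i * n).
  by rewrite mulrz_suml; apply: eq_bigr => i _; rewrite mulrzA.
have PN v : P v -> P (- v) by rewrite -mulrN1z; apply: PZ.
have P0 : P 0 by exists (fun=> 0); rewrite big1 // => i _; rewrite mulr0z.
have PS n (F : 'I_n -> V) : (forall i, P (F i)) -> P (\sum_i F i).
  by move=> PF; apply: (big_ind P).
have Pd (i : nat) : (i < N)%N -> P (d i).
  move=> iN; exists (fun k => (k == Ordinal iN)%:Z).
  rewrite (bigD1 (Ordinal iN)) //= eqxx mulr1z big1 ?addr0 // => k.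
  by move=> /negPf ->; rewrite mulr0z.
have PdN : P (d N).
  have := rel 0; rewrite big_ord_recr /= cN mulr1z add0r => /eqP.
  rewrite addr_eq0 => /eqP E; rewrite -[d N]opprK -E; apply/PN/PS => i.
  by rewrite add0r; apply/PZ/Pd.
have PdN1 : P (d (-1)).
  have := rel (-1); rewrite big_ord_recl /= c0 mulr1z addr0 => /eqP.
  rewrite addr_eq0 => /eqP ->; apply/PN/PS => i; apply: PZ.
  have -> : -1 + (bump 0 i)%:Z = i :> int by rewrite /bump; lia.
  exact: Pd.
apply: span_d => //; apply: (@stable_d P _ _ 0) => [v|v|]; last exact: (Pd 0%N).
- move=> [b ->]; rewrite (morphS phiD); apply: PS => i.
  rewrite (morphZ phiD) phi_d; apply: PZ.
  have := ltn_ord i; rewrite leq_eqVlt => /predU1P[iN|]; last first.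
    by rewrite -addn1 => iN; have := Pd _ iN; rewrite PoszD.
  by rewrite -iN -addn1 PoszD in PdN.
- move=> [b ->]; rewrite (morphS psiD); apply: PS => i.
  rewrite (morphZ psiD) psi_d; apply: PZ; have := ltn_ord i.
  case: (nat_of_ord i) => [_|k kN]; first by rewrite add0r.
  have -> : k.+1%:Z - 1 = k by lia.
  by apply/Pd/ltnW.
Qed.

(** A prime [p] that does not divide [k + 1], where [- a = s k], satisfies
    [V = p V]: modulo the image of [phi - 1] the element [s n] is [n] times [a],
    so that [(k + 1) a] lies in that image.  Hence [a] lies in it modulo [p V],
    which amounts to some [d n] lying in [p V]; then all the [d n] do. *)
Let divisible : phi a = a \/ exists2 p, prime p &
  forall v, exists w : V, v = w *~ p%:Z.
Proof.
have [k kE] := s_surj (- a).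
have [k1|k1] := eqVneq k (-1).
  left; have := sS (-1); rewrite addNr s0 -k1 -kE -[phi (- a)]mulr1z.
  rewrite -mulrN1z (morphZ phiD) mulrN1z mulr1z => /eqP.
  by rewrite eq_sym subr_eq0 => /eqP.
have [p p_gt pr_p] := prime_above `|k + 1|.
right; exists p => //.
have phi0 : phi 0 = 0 by rewrite -(mulr0z a) (morphZ phiD) mulr0z.
have sE n : exists z, s n = a *~ n + (phi z - z).
  elim/int_ind2: n => [|n [z IH]|n [z IH]].
  - by exists 0; rewrite s0 mulr0z phi0 subrr addr0.
  - exists (z + s n); rewrite phiD opprD mulrzDr mulr1z.
    rewrite [phi z + _ + _]addrACA [a *~ n + a + _]addrACA -IH sS.
    by rewrite [s n + _]addrC -!addrA addNr addr0.
  - have := sS (n - 1); rewrite subrK IH; move: (s (n - 1)) => t E.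
    exists (z - t); rewrite phiB opprB mulrzBr mulr1z.
    have -> : phi z - phi t + (t - z) = phi z - z + (t - phi t).
      by rewrite -!addrA; congr (_ + _); rewrite addrC -addrA [RHS]addrCA.
    by rewrite addrACA E addrACA subrr add0r addrC subrK.
have [z kz] := sE k; have [[u w] /= uw] : exists uw : int * int,
    uw.1 * (k + 1) + uw.2 * p%:Z = 1.
  have /coprimezP [uw E] : coprimez (k + 1) p%:Z.
    rewrite coprimezE /= coprime_sym prime_coprime // gtnNdvd //.
    by rewrite absz_gt0; apply: contra k1; rewrite addr_eq0.
  by exists uw.
have [n nE] := s_surj (z *~ u).
have dn : d n = a *~ w *~ p%:Z.
  have E : a *~ (k + 1) = z - phi z.
    apply/eqP; rewrite -subr_eq0 mulrzDr mulr1z opprB addrAC -kz -kE.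
    by rewrite addNr.
  rewrite dE sS -nE (morphZ phiD).
  rewrite -{1}[a]mulr1z -uw mulrzDr [u * _]mulrC !mulrzA E mulrzBl.
  by rewrite [_ - _ + _]addrC -!addrA addKr subrr addr0.
apply: span_d.
- by exists 0; rewrite mul0rz.
- by move=> _ _ [x ->] [y ->]; exists (x + y); rewrite mulrzDl.
- by move=> _ [x ->]; exists (- x); rewrite mulNrz.
apply: (@stable_d (fun v => exists w : V, v = w *~ p%:Z) _ _ n) => [v|v|].
- by move=> [x ->]; exists (phi x); rewrite (morphZ phiD).
- by move=> [x ->]; exists (psi x); rewrite (morphZ psiD).
- by exists (a *~ w).
Qed.

(** Nakayama: the matrix that expresses generators [e] through their [p]-th
    parts yields a nonzero integer that kills [V]. *)
Let nakayama (p N : nat) (e : 'I_N -> V) : prime p ->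
    (forall v, exists w : V, v = w *~ p%:Z) ->
    (forall v, exists b : 'I_N -> int, v = \sum_(i < N) e i *~ b i) ->
  exists2 q : int, q != 0 & forall v : V, v *~ q = 0.
Proof.
move=> pr_p pV eV.
have eM i : exists b : 'I_N -> int, e i = \sum_(k < N) e k *~ (p%:Z * b k).
  have [w ->] := pV (e i); have [b ->] := eV w; exists b.
  by rewrite mulrz_suml; apply: eq_bigr => k _; rewrite -mulrzA mulrC.
have [b bE] := choice eM.
pose M : 'M[int]_N := \matrix_(i, k) b i k.
pose A : 'M[int]_N := 1%:M - p%:Z *: M.
have Ae i : \sum_k e k *~ A i k = 0.
  rewrite (eq_bigr (fun k =>
    e k *~ (1%:M : 'M[int]_N) i k - e k *~ (p%:Z * b i k))).
    rewrite sumrB -bE (bigD1 i) //= mxE eqxx mulr1z big1 ?addr0 ?subrr // => k.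
    by rewrite mxE eq_sym => /negPf ->; rewrite mulr0z.
  by move=> k _; rewrite !mxE mulrzBr.
have dete k : e k *~ \det A = 0.
  have : \sum_i (\sum_k' e k' *~ A i k') *~ (\adj A k i) = 0.
    by rewrite big1 // => i _; rewrite Ae mul0rz.
  rewrite (eq_bigr (fun i => \sum_k' e k' *~ (\adj A k i * A i k'))).
    rewrite exchange_big /=.
    rewrite (eq_bigr (fun k' => e k' *~ (\adj A *m A) k k')).
      rewrite mul_adj_mx (bigD1 k) //= mxE eqxx mulr1n big1 ?addr0 // => k'.
      by rewrite mxE eq_sym => /negPf ->; rewrite mulr0z.
    by move=> k' _; rewrite mxE mulrz_sumr.
  by move=> i _; rewrite mulrz_suml; apply: eq_bigr => k' _;
    rewrite -mulrzA mulrC.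
exists (\det A).
  apply/eqP => det0; have : ((\det A)%:~R : 'F_p) = 0 by rewrite det0.
  rewrite -det_map_mx (_ : map_mx _ A = 1%:M) ?det1 => [/eqP|].
    by rewrite oner_eq0.
  apply/matrixP => i k; rewrite !mxE rmorphB rmorphM /= rmorph_nat.
  by rewrite [p%:~R]pchar_Fp_0 // mul0r subr0.
move=> v; have [c ->] := eV v; rewrite mulrz_suml big1 // => i _.
by rewrite -mulrzA mulrC mulrzA dete mul0rz.
Qed.

Theorem regular_affine_fix : phi a = a.
Proof.
(* Otherwise [V] is finitely generated and of finite exponent, hence finite,
   against the injectivity of [s]. *)
have [//|[N [c [m [N0 c0 cN rel]]]]] := relation.
have [//|[p pr_p pV]] := divisible.
have eV := module_span N0 c0 cN rel.
have [q q0 qV] := nakayama pr_p pV eV; exfalso.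
pose g (f : {ffun 'I_N -> 'I_`|q|}) := \sum_(i < N) d i *~ (f i : nat)%:Z.
have gfin : finite_set (range g) by exact/finite_image/finite_finset.
have gs (i : nat) : range g (s i).
  have [b ->] := eV (s i).
  have ltb (k : 'I_N) : (`|(b k %% q)%Z| < `|q|)%N.
    have := @ltz_mod (b k) q; have := @modz_ge0 (b k) q; lia.
  exists [ffun k => Ordinal (ltb k)] => //; apply: eq_bigr => k _.
  rewrite ffunE /= gez0_abs ?modz_ge0 //.
  by rewrite [in RHS](divz_eq (b k) q) [RHS]mulrzDr mulrC mulrzA qV mul0rz add0r.
have [i [k [ltik /s_inj [E]]]] := finite_repeat gfin gs.
by rewrite E ltnn in ltik.
Qed.

End RegularAffine.

(** * Arithmetic of skew braces *)

Section Arithmetic.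
Variable B : skewBraceType.
Implicit Types (a b c d : B) (S D : set B).

Lemma sb_addKN a b : - a + (a + b) = b.
Proof. exact: (mulKg (a : addg B)). Qed.

Lemma sb_addNK a b : a + (- a + b) = b.
Proof. exact: (mulVKg (a : addg B)). Qed.

Lemma sb_oppK a : - - a = a.
Proof. exact: (invgK (a : addg B)). Qed.

Lemma sb_oppD a b : - (a + b) = - b - a.
Proof. exact: (invgM (a : addg B)). Qed.

Lemma sb_opp0 : - 0 = 0 :> B.
Proof. exact: (invg1 (addg B)). Qed.

Lemma sb_addI a b c : a + b = a + c -> b = c.
Proof. exact: (mulgI (a : addg B)). Qed.

Lemma sb_addIr a b c : b + a = c + a -> b = c.
Proof. exact: (mulIg (a : addg B)). Qed.

Definition sb_simp := (sb_oppD, sb_oppK, sb_opp0, @sb_add0 B, @sb_add0' B,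
  @sb_addN B, @sb_addN' B, sb_addKN, sb_addNK).

Lemma lambdaE a b : lambda a b = - a + a ∘ b. Proof. by []. Qed.

Lemma circ_lambda a b : a ∘ b = a + lambda a b.
Proof. by rewrite /lambda sb_addNK. Qed.

Lemma lambdaD a b c : lambda a (b + c) = lambda a b + lambda a c.
Proof. by rewrite /lambda sb_circD -!sb_addA. Qed.

Lemma lambda0 a : lambda a 0 = 0.
Proof. by rewrite /lambda sb_circ0 sb_addN. Qed.

Lemma lambdaN a b : lambda a (- b) = - lambda a b.
Proof.
by apply: (@sb_addI (lambda a b)); rewrite -lambdaD !sb_simp lambda0.
Qed.

Lemma lambdaK a b : lambda a^-1 (lambda a b) = b.
Proof. by rewrite lambda_circ mulVg lambda1. Qed.

Lemma lambdaVK a b : lambda a (lambda a^-1 b) = b.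
Proof. by rewrite lambda_circ mulgV lambda1. Qed.

Lemma lambda_inj a : injective (lambda a).
Proof. exact: can_inj (lambdaK a). Qed.

Lemma lambda_inv a : lambda a a^-1 = - a.
Proof. by rewrite /lambda mulgV sb_one0 sb_add0'. Qed.

Lemma inv_lambda a : a^-1 = lambda a^-1 (- a).
Proof. by rewrite -lambda_inv lambdaK. Qed.

Lemma lambda_zexp a b n :
  lambda a (zexp (b : addg B) n) = zexp (lambda a b : addg B) n.
Proof. exact: (@zexp_morph (addg B) (addg B) (lambda a) b n (lambdaD a)). Qed.

(** Additively closed sets that are stable under enough of the maps [lambda]
    are sub-skew braces, since [a ∘ b = a + lambda a b]. *)
Lemma lambda_stable_sub S D : subgroup (S : set (addg B)) ->
  subgroup D -> S `<=` D -> (forall d x, D d -> S x -> S (lambda d x)) ->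
  sub_skew_brace S.
Proof.
move=> Ssub [_ _ DV] SD Slam; split=> //; case: Ssub => S0 SM SV; split.
- by rewrite sb_one0.
- move=> x y Sx Sy; rewrite circ_lambda; apply: SM => //.
  by apply: Slam => //; apply: SD.
- move=> x Sx; rewrite inv_lambda; apply: Slam; first by apply/DV/SD.
  exact: SV.
Qed.

Lemma sub_set0 : sub_skew_brace [set (0 : B)].
Proof.
split; split=> //=.
- by move=> _ _ -> ->; apply: sb_add0.
- by move=> _ ->; apply: sb_opp0.
- exact: sb_one0.
- by move=> _ _ -> ->; rewrite sb_circ0.
- by move=> _ ->; rewrite -sb_one0 invg1.
Qed.

Section SubClosure.
Variables (S : set B) (Ssub : sub_skew_brace S).

Lemma sub0 : S 0. Proof. by case: Ssub => -[]. Qed.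
Lemma subD a b : S a -> S b -> S (a + b).
Proof. by case: Ssub => -[_ H _] _; apply: H. Qed.
Lemma subN a : S a -> S (- a).
Proof. by case: Ssub => -[_ _ H] _; apply: H. Qed.
Lemma subM a b : S a -> S b -> S (a ∘ b).
Proof. by case: Ssub => _ [_ H _]; apply: H. Qed.
Lemma subV a : S a -> S a^-1.
Proof. by case: Ssub => _ [_ _ H]; apply: H. Qed.
Lemma sub_lambda a b : S a -> S b -> S (lambda a b).
Proof. by move=> Sa Sb; apply: subD; [apply: subN | apply: subM]. Qed.

End SubClosure.

Lemma setI_sub S D : sub_skew_brace S -> sub_skew_brace D ->
  sub_skew_brace (S `&` D).
Proof.
move=> Ss Ds; split; split; (try by split; exact: sub0).
- by move=> x y [Sx Dx] [Sy Dy]; split; apply: subD.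
- by move=> x [Sx Dx]; split; apply: subN.
- by rewrite sb_one0; split; exact: sub0.
- by move=> x y [Sx Dx] [Sy Dy]; split; apply: subM.
- by move=> x [Sx Dx]; split; apply: subV.
Qed.

(** Serves for unions of chains and for unions of finite sub-skew braces. *)
Lemma directed_sub (U : set B) : U 0 ->
    (forall x y, U x -> U y ->
      exists S, [/\ sub_skew_brace S, S `<=` U, S x & S y]) ->
  sub_skew_brace U.
Proof.
move=> U0 dir; split; split=> //.
- move=> x y Ux Uy; have [S [Ss SU Sx Sy]] := dir _ _ Ux Uy.
  by apply: SU; apply: subD.
- move=> x Ux; have [S [Ss SU Sx _]] := dir _ _ Ux Ux.
  by apply: SU; apply: subN.
- by rewrite sb_one0.
- move=> x y Ux Uy; have [S [Ss SU Sx Sy]] := dir _ _ Ux Uy.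
  by apply: SU; apply: subM.
- move=> x Ux; have [S [Ss SU Sx _]] := dir _ _ Ux Ux.
  by apply: SU; apply: subV.
Qed.

Section IdealClosure.
Variables (S : set B) (Sid : is_ideal S).

Lemma ideal_sub : sub_skew_brace S.
Proof. by case: Sid => -[? _] _ [? _]. Qed.

Lemma ideal_lambda b a : S a -> S (lambda b a).
Proof. by case: Sid => _ H _; apply: H. Qed.

Lemma ideal_conjD b a : S a -> S (- b + (a + b)).
Proof. by case: Sid => -[_ H] _ _; apply: H. Qed.

Lemma ideal_conjM b a : S a -> S (a ^ b).
Proof. by case: Sid => _ _ [_ H]; apply: H. Qed.

End IdealClosure.

Definition sum_set S D : set B := [set x | exists a b, [/\ S a, D b & x = a + b]].

Lemma sum_set_sub S D : is_ideal S -> is_ideal D ->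
  sub_skew_brace (sum_set S D).
Proof.
move=> Sid Did; have [Ss Ds] := (ideal_sub Sid, ideal_sub Did).
apply: (@lambda_stable_sub _ setT) => //; first split.
- by exists 0, 0; split; [exact: sub0|exact: sub0|rewrite sb_add0].
- move=> _ _ [a [b [Sa Db ->]]] [a' [b' [Sa' Db' ->]]].
  exists (a + a'), (- a' + (b + a') + b'); split.
  + exact: subD.
  + by apply: subD => //; apply: ideal_conjD.
  + by rewrite -!sb_addA !sb_simp; exact: (esym (sb_addA a b (a' + b'))).
- move=> _ [a [b [Sa Db ->]]].
  exists (- a), (- - a + (- b + - a)); split; first exact: subN.
  + by apply: ideal_conjD => //; apply: subN.
  + by rewrite !sb_simp; exact: sb_oppD.
- move=> d _ _ [a [b [Sa Db ->]]]; exists (lambda d a), (lambda d b).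
  by split; [exact: ideal_lambda|exact: ideal_lambda|rewrite lambdaD].
Qed.

Lemma sum_set_finite S D : finite_set S -> finite_set D ->
  finite_set (sum_set S D).
Proof.
move=> Sf Df; apply: sub_finite_set (finite_image2 (@sb_add B) Sf Df).
by move=> _ [a [b [Sa Db ->]]]; exists a => //; exists b.
Qed.

(** Equivalently [c ∘ c = c + c]; the additive and the multiplicative powers of
    [c] then agree. *)
Definition self_fixed c := lambda c c = c.

Section SelfFixed.
Variables (c : B) (cfix : self_fixed c).

Lemma self_fixed_stab n : lambda (zexp c n) c = c.
Proof.
have cV : lambda c^-1 c = c by rewrite -{2}cfix lambdaK.
elim/int_ind2: n => [|n IH|n IH]; first exact: lambda1.
  by rewrite zexpS -lambda_circ cfix.
by rewrite zexpB1 -lambda_circ cV.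
Qed.

Lemma self_fixed_zexp n : zexp (c : addg B) n = zexp c n :> B.
Proof.
have cV : c^-1 = - c.
  by apply: (@lambda_inj c); rewrite lambda_inv lambdaN cfix.
have addc n' b : lambda (zexp c n') b = b -> zexp c n' ∘ b = zexp c n' + b.
  by rewrite circ_lambda => ->.
elim/int_ind2: n => [|n IH|n IH]; first exact/esym/sb_one0.
  by rewrite !zexpS -IH -[RHS]/(_ ∘ c) IH addc ?self_fixed_stab // -IH.
rewrite !zexpB1 -[RHS]/(_ ∘ c^-1) cV addc; first by rewrite -IH.
by rewrite lambdaN self_fixed_stab.
Qed.

Lemma self_fixed_cyc_add : cyc (c : addg B) = cyc c :> set B.
Proof.
by apply/seteqP; split=> _ [n _ <-]; exists n => //; rewrite self_fixed_zexp.
Qed.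

Lemma cyc_sub_skew_brace : sub_skew_brace (cyc c).
Proof.
split; last exact: cyc_subgroup.
by rewrite -self_fixed_cyc_add; exact: cyc_subgroup.
Qed.

Lemma self_fixed_torsion : torsion c <-> torsion (c : addg B).
Proof.
split=> -[k k0 E]; exists k => //.
  exact: etrans (self_fixed_zexp k) (etrans E (sb_one0 B)).
exact: etrans (esym (self_fixed_zexp k)) (etrans E (esym (sb_one0 B))).
Qed.

End SelfFixed.

(** For [c] that commutes with [b] in both groups, [lambda b c = c] and
    [lambda c b = b] are equivalent; the former puts the condition in terms of
    an action on [c]. *)
Lemma sb_centerP c : sb_center B c <->
  forall b, [/\ lambda b c = c, b + c = c + b & b ∘ c = c ∘ b].
Proof.
split=> [[[/= Lc Ac] Mc] b|H].
  have Acb : b + c = c + b by exact/esym/Ac.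
  have Mcb : b ∘ c = c ∘ b by exact/esym/Mc.
  split=> //; apply: (@sb_addI b).
  by rewrite -circ_lambda Mcb circ_lambda Lc.
split; first split.
- move=> b; have [Lb Ab Mb] := H b; apply: (@sb_addI c).
  by rewrite -circ_lambda -Mb circ_lambda Lb.
- by move=> b; have [_ Ab _] := H b; apply/esym.
- by move=> b; have [_ _ Mb] := H b; apply/esym.
Qed.

(** The elements fixed by the three families of automorphisms; this form is
    compared most easily with its counterpart in a quotient. *)
Lemma sb_center_conjP c : sb_center B c <->
  forall b, [/\ lambda b c = c, - b + (c + b) = c & c ^ b = c].
Proof.
split=> [/sb_centerP Zc b|H].
  have [Lb Ab Mb] := Zc b; split=> //; first by rewrite -Ab sb_addKN.
  by rewrite /conjg -[c * b]Mb mulKg.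
apply/sb_centerP => b; have [Lb Ab Mb] := H b; split=> //.
  by rewrite -{1}Ab sb_addNK.
by rewrite -{1}Mb /conjg mulVKg.
Qed.

Lemma center_self_fixed c : sb_center B c -> self_fixed c.
Proof. by move=> [[Lc _] _]; apply: Lc. Qed.

Lemma sb_center_sub : sub_skew_brace (sb_center B).
Proof.
have ZD a b : sb_center B a -> sb_center B b -> sb_center B (a + b).
  move=> /sb_centerP Za /sb_centerP Zb; have Zab : a + b = a ∘ b.
    by rewrite circ_lambda; have [-> _ _] := Zb a.
  apply/sb_centerP => d; have [[La Aa Ma] [Lb Ab Mb]] := (Za d, Zb d); split.
  - by rewrite lambdaD La Lb.
  - by rewrite sb_addA Aa -sb_addA Ab sb_addA.
  - by rewrite Zab mulgA Ma -mulgA Mb mulgA.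
have ZV a : sb_center B a -> a^-1 = - a.
  move=> Za; have [Lv _ _] := (sb_centerP a).1 Za a^-1.
  by rewrite inv_lambda lambdaN Lv.
have ZN a : sb_center B a -> sb_center B (- a).
  move=> Za; apply/sb_centerP => d; have [La Aa Ma] := (sb_centerP a).1 Za d; split.
  - by rewrite lambdaN La.
  - exact: (@commuteV (addg B)).
  - by rewrite -ZV //; exact: commuteV.
have Z0 : sb_center B 0.
  apply/sb_centerP => d; split; first exact: lambda0.
    by rewrite sb_add0 sb_add0'.
  by rewrite -sb_one0 mulg1 mul1g.
split; split=> //; first by rewrite sb_one0.
  move=> a b Za Zb; rewrite circ_lambda.
  by have [-> _ _] := (sb_centerP b).1 Zb a; apply: ZD.
by move=> a Za; rewrite ZV //; apply: ZN.
Qed.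

End Arithmetic.

(** * Morphisms and quotients *)

Definition sb_morph (B B' : skewBraceType) (f : B -> B') :=
  {morph f : x y / x + y} /\ {morph f : x y / x ∘ y}.

Section Morphisms.
Variables (B B' : skewBraceType) (f : B -> B') (fM : sb_morph f).
Implicit Types (x y : B) (S : set B) (T : set B').

Lemma sb_morphD : {morph f : x y / x + y}. Proof. exact: fM.1. Qed.
Lemma sb_morphM : {morph f : x y / x ∘ y}. Proof. exact: fM.2. Qed.

Lemma sb_morph0 : f 0 = 0.
Proof. by apply: (@sb_addI _ (f 0)); rewrite -sb_morphD !sb_add0'. Qed.

Lemma sb_morphN x : f (- x) = - f x.
Proof.
by apply: (@sb_addI _ (f x)); rewrite -sb_morphD !sb_addN' sb_morph0.
Qed.

Lemma sb_morphV x : f x^-1 = (f x)^-1.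
Proof. by apply/esym/mulg1_eq; rewrite -sb_morphM mulgV !sb_one0 sb_morph0. Qed.

Lemma sb_morph_lambda x y : f (lambda x y) = lambda (f x) (f y).
Proof. by rewrite /lambda sb_morphD sb_morphN sb_morphM. Qed.

Lemma sb_morph_zexp x n : f (zexp x n) = zexp (f x) n.
Proof. exact/zexp_morph/sb_morphM. Qed.

Lemma sb_morph_azexp x n : f (zexp (x : addg B) n) = zexp (f x : addg B') n.
Proof. exact: (@zexp_morph (addg B) (addg B') f x n sb_morphD). Qed.

Lemma sb_morph_eq x y : f x = f y <-> f (- x + y) = 0.
Proof.
rewrite sb_morphD sb_morphN; split=> [->|E]; first exact: sb_addN.
by rewrite -[RHS](sb_addNK (f x)) E sb_add0'.
Qed.

Lemma sb_morph_conjD x y : f (- y + (x + y)) = - f y + (f x + f y).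
Proof. by rewrite !sb_morphD sb_morphN. Qed.

Lemma sb_morph_conjM x y : f (x ^ y) = f x ^ f y.
Proof. by rewrite /conjg !sb_morphM sb_morphV. Qed.

Lemma preimage_sub_brace T : sub_skew_brace T -> sub_skew_brace (f @^-1` T).
Proof.
move=> Ts; split; split=> /=.
- by rewrite [f _]sb_morph0; exact: sub0.
- by move=> x y Tx Ty; rewrite [f _]sb_morphD; apply: subD.
- by move=> x Tx; rewrite [f _]sb_morphN; apply: subN.
- by rewrite sb_one0 sb_morph0; exact: sub0.
- by move=> x y Tx Ty; rewrite sb_morphM; apply: subM.
- by move=> x Tx; rewrite sb_morphV; apply: subV.
Qed.

Lemma image_sub_brace S : sub_skew_brace S -> sub_skew_brace (f @` S).
Proof.
move=> Ss; split; split=> /=.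
- by exists 0; [exact: sub0|rewrite sb_morph0].
- move=> _ _ [x Sx <-] [y Sy <-]; exists (x + y); first exact: subD.
  exact: sb_morphD.
- move=> _ [x Sx <-]; exists (- x); first exact: subN.
  exact: sb_morphN.
- by exists 0; [exact: sub0|rewrite sb_morph0 sb_one0].
- move=> _ _ [x Sx <-] [y Sy <-]; exists (x ∘ y); first exact: subM.
  exact: sb_morphM.
- move=> _ [x Sx <-]; exists x^-1; first exact: subV.
  exact: sb_morphV.
Qed.

Lemma Dedekind_morph : range f = setT -> Dedekind B -> Dedekind B'.
Proof.
move=> fT dB T Ts; have Tid := dB _ (preimage_sub_brace Ts).
have lift (y : B') : exists x, f x = y.
  by have : range f y by [rewrite fT]; move=> [x _ <-]; exists x.
split; first split; first exact: Ts.1.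
- move=> y z; have [[x <-] [t <-]] := (lift y, lift z) => Tx.
  by have := ideal_conjD Tid t Tx; rewrite /preimage /= sb_morph_conjD.
- move=> z y; have [[x <-] [t <-]] := (lift y, lift z) => Tx.
  by have := ideal_lambda Tid t Tx; rewrite /preimage /= sb_morph_lambda.
split; first exact: Ts.2.
move=> y z; have [[x <-] [t <-]] := (lift y, lift z) => Tx.
by have := ideal_conjM Tid t Tx; rewrite /preimage /= sb_morph_conjM.
Qed.

End Morphisms.

Lemma comp_morph (B B' B'' : skewBraceType) (g : B' -> B'') (f : B -> B') :
  sb_morph g -> sb_morph f -> sb_morph (g \o f).
Proof.
move=> gM fM; split=> x y /=; first by rewrite (sb_morphD fM) (sb_morphD gM).
by rewrite (sb_morphM fM) (sb_morphM gM).
Qed.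

Section Quotients.
Variables (B : skewBraceType) (N : ideal B).

Definition qproj : B -> quot_brace N := \pi_(quot_brace N).

Lemma qproj_morph : sb_morph qproj.
Proof.
by split=> x y; [exact: Defs.pi_add | exact: Defs.pi_circ].
Qed.

Definition qrepr (y : quot_brace N) : B := generic_quotient.repr y.

Lemma qproj_repr (y : quot_brace N) : qproj (qrepr y) = y.
Proof. exact: reprK. Qed.

Lemma qproj_surj : range qproj = setT.
Proof. by apply/seteqP; split=> // y _; exists (qrepr y); rewrite ?qproj_repr. Qed.

Lemma qproj_eq x y : qproj x = qproj y <-> ideal_set N (- x + y).
Proof. exact: quot_braceE. Qed.

Lemma qproj_circ_eq x y : qproj x = qproj y <-> ideal_set N (x^-1 ∘ y).
Proof. exact: quot_brace_circE. Qed.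

Lemma qproj_eq0 x : qproj x = 0 <-> ideal_set N x.
Proof.
rewrite -(sb_morph0 qproj_morph); split=> [/esym/qproj_eq|Nx].
  by rewrite sb_opp0 sb_add0.
by apply/esym/qproj_eq; rewrite sb_opp0 sb_add0.
Qed.

Lemma quot_Dedekind : Dedekind B -> Dedekind (quot_brace N).
Proof. exact: Dedekind_morph qproj_morph qproj_surj. Qed.

Lemma qproj_preimage_finite (F : set (quot_brace N)) :
  finite_set N -> finite_set F -> finite_set (qproj @^-1` F).
Proof.
move=> Nfin Ffin.
apply: sub_finite_set (finite_image2 (fun y n => qrepr y + n) Ffin Nfin).
move=> x Fx; exists (qproj x) => //; exists (- qrepr (qproj x) + x).
  by apply/qproj_eq; rewrite qproj_repr.
by rewrite sb_addNK.
Qed.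

(** The composite [f \o qrepr] is the factorisation of [f] through a quotient by
    a part of its kernel. *)
Lemma quot_lift (B' : skewBraceType) (f : B -> B') :
    sb_morph f -> (forall x, ideal_set N x -> f x = 0) ->
  sb_morph (f \o qrepr) /\
  forall x, f (qrepr (qproj x)) = f x.
Proof.
move=> fM fN.
have fr x : f (qrepr (qproj x)) = f x.
  by apply/(sb_morph_eq fM)/fN/qproj_eq; rewrite qproj_repr.
split=> //; split=> y z /=.
  rewrite -{1}(qproj_repr y) -{1}(qproj_repr z) -(sb_morphD qproj_morph) fr.
  exact: sb_morphD.
rewrite -{1}(qproj_repr y) -{1}(qproj_repr z) -(sb_morphM qproj_morph) fr.
exact: sb_morphM.
Qed.

End Quotients.

Arguments qproj {B} N _.

(** * Tame quotients *)

Definition finite_elt (B : skewBraceType) (y : B) :=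
  exists F, [/\ sub_skew_brace F, finite_set F & F y].

(** The two kinds of elements that an ascending series with the given factors
    makes available in each nonzero quotient. *)
Definition tame (B : skewBraceType) (y : B) := finite_elt y \/ self_fixed y.

(** What is used of the ascending series; unlike the series, it passes to
    quotients at once. *)
Definition tame_quotients (B : skewBraceType) :=
  forall (B' : skewBraceType) (f : B -> B'), sb_morph f -> range f = setT ->
    (exists y : B', y <> 0) -> exists2 y : B', y <> 0 & tame y.

Lemma tame_quotients_morph (B B' : skewBraceType) (f : B -> B') :
  sb_morph f -> range f = setT -> tame_quotients B -> tame_quotients B'.
Proof.
move=> fM fT tB B'' g gM gT; apply: (tB _ (g \o f)); first exact: comp_morph.
apply/seteqP; split=> // z _.
have [y _ <-] : range g z by rewrite gT.
have [x _ <-] : range f y by rewrite fT.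
by exists x.
Qed.

Lemma quot_tame (B : skewBraceType) (N : ideal B) :
  tame_quotients B -> tame_quotients (quot_brace N).
Proof. exact: tame_quotients_morph (qproj_morph N) (qproj_surj N). Qed.

(** * Cauchy's theorem for skew braces *)

(** Bundled so that finite subgroups of the additive and of the multiplicative
    group become finite group types by one and the same construction. *)
Record finite_subgroup (G : groupType) := FiniteSubgroup {
  fsg_set : {fset G};
  fsg_subgroup : subgroup [set x | x \in fsg_set] }.

Definition fsg (G : groupType) (S : finite_subgroup G) : Type := fsg_set S.

Section FiniteSubgroup.
Variables (G : groupType) (S : finite_subgroup G).

HB.instance Definition _ := Finite.copy (fsg S) (fsg_set S).

Definition fsg_val (x : fsg S) : G := val (x : fsg_set S).

Lemma fsg_inj : injective fsg_val. Proof. exact: val_inj. Qed.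

Definition fsg_one : fsg S :=
  let: And3 S1 _ _ := fsg_subgroup S in [` S1 : 1 \in fsg_set S]%fset.
Definition fsg_mul (x y : fsg S) : fsg S :=
  let: And3 _ SM _ := fsg_subgroup S in
  [` SM _ _ (fsvalP x) (fsvalP y) : fsg_val x * fsg_val y \in fsg_set S]%fset.
Definition fsg_inv (x : fsg S) : fsg S :=
  let: And3 _ _ SV := fsg_subgroup S in
  [` SV _ (fsvalP x) : (fsg_val x)^-1 \in fsg_set S]%fset.

Lemma fsg_val1 : fsg_val fsg_one = 1.
Proof. by rewrite /fsg_one; case: (fsg_subgroup S). Qed.
Lemma fsg_valM x y : fsg_val (fsg_mul x y) = fsg_val x * fsg_val y.
Proof. by rewrite /fsg_mul; case: (fsg_subgroup S). Qed.
Lemma fsg_valV x : fsg_val (fsg_inv x) = (fsg_val x)^-1.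
Proof. by rewrite /fsg_inv; case: (fsg_subgroup S). Qed.

Lemma fsg_mulA : associative fsg_mul.
Proof. by move=> x y z; apply: fsg_inj; rewrite !fsg_valM mulgA. Qed.
Lemma fsg_mul1 : left_id fsg_one fsg_mul.
Proof. by move=> x; apply: fsg_inj; rewrite fsg_valM fsg_val1 mul1g. Qed.
Lemma fsg_mulV : left_inverse fsg_one fsg_inv fsg_mul.
Proof.
by move=> x; apply: fsg_inj; rewrite fsg_valM fsg_valV fsg_val1 mulVg.
Qed.

HB.instance Definition _ := Finite_isGroup.Build (fsg S) fsg_mulA fsg_mul1 fsg_mulV.

Lemma fsg_valX x n : fsg_val (x ^+ n) = fsg_val x ^+ n.
Proof.
elim: n => [|n IH]; first exact: fsg_val1.
by rewrite !expgS [LHS]fsg_valM IH.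
Qed.

Lemma fsg_order x : x \in fsg_set S -> x ^+ #|{: fsg S}| = 1.
Proof.
move=> Sx; pose y : fsg S := [` Sx]%fset.
have E : y ^+ #|{: fsg S}| = 1%g by rewrite -cardsT expg_cardG ?inE.
by have := congr1 fsg_val E; rewrite fsg_valX [RHS]fsg_val1.
Qed.

End FiniteSubgroup.

(** Cauchy's theorem for skew braces, by [cocycle_Cauchy] with the identity of
    [S] as the cocycle; [n] is the order of [S]. *)
Lemma finite_sub_Cauchy (B : skewBraceType) (S : set B) :
    sub_skew_brace S -> finite_set S ->
  exists n : nat, [/\ (0 < n)%N, n = 1%N -> S `<=` [set 0],
    forall b, S b -> b ^+ n = 1 /\ (b : addg B) ^+ n = 1
  & forall q, prime q -> q %| n ->
      exists c, [/\ S c, c <> 0, c ^+ q = 1 & self_fixed c]].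
Proof.
move=> Ss Sfin.
have SE (x : B) : x \in fset_set S <-> S x.
  by rewrite in_fset_set // in_setE.
have cP : subgroup [set x : B | x \in fset_set S].
  split=> /=; first by apply/SE; rewrite sb_one0; exact: sub0.
    by move=> x y /SE Sx /SE Sy; apply/SE; apply: subM => //.
  by move=> x /SE Sx; apply/SE; apply: subV.
pose A : {fset addg B} := fset_set S.
have aP : subgroup [set x : addg B | x \in A].
  split=> /=; first by apply/SE; exact: sub0.
    by move=> x y /SE Sx /SE Sy; apply/SE; exact: subD.
  by move=> x /SE Sx; apply/SE; exact: subN.
pose cT : finGroupType := fsg (FiniteSubgroup cP).
pose aT : finGroupType := fsg (FiniteSubgroup aP).
pose vC (c : cT) : B := @fsg_val _ (FiniteSubgroup cP) c.
pose vA (x : aT) : B := @fsg_val _ (FiniteSubgroup aP) x.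
have vCM c d : vC (c * d) = vC c ∘ vC d.
  exact: (@fsg_valM _ (FiniteSubgroup cP) c d).
have vAM x y : vA (x * y) = vA x + vA y.
  exact: (@fsg_valM _ (FiniteSubgroup aP) x y).
have vC1 : vC 1 = 1 := @fsg_val1 _ (FiniteSubgroup cP).
have vC_inj : injective vC := @fsg_inj _ _.
have vA_inj : injective vA := @fsg_inj _ _.
pose i (x : cT) : aT := x; pose j (x : aT) : cT := x.
have lP (c : cT) (x : aT) : lambda (vC c) (vA x) \in A.
  apply/SE; apply: sub_lambda => //; apply/SE; first exact: (fsvalP c).
  exact: (fsvalP x).
pose l (c : cT) (x : aT) : aT := [` lP c x]%fset.
have lV c x : vA (l c x) = lambda (vC c) (vA x) by [].
have cc q : prime q -> (q %| #|cT|)%N ->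
    exists c : cT, [/\ c != 1, c ^+ q = 1 & l c (i c) = i c].
  apply: (@cocycle_Cauchy cT aT i j l) => //.
  - by move=> c x y; apply: vA_inj; rewrite vAM !lV vAM lambdaD.
  - by move=> c d x; apply: vA_inj; rewrite !lV lambda_circ vCM.
  - by move=> x; apply: vA_inj; rewrite lV vC1 lambda1.
  - by move=> c d; apply: vA_inj; rewrite vAM lV [LHS]vCM circ_lambda.
exists #|cT|; split.
- by apply/card_gt0P; exists 1.
- move=> c1 x Sx; have /SE Ax := Sx; pose y : cT := [` Ax]%fset.
  have /fintype_le1P/(_ 1 y) : (#|cT| <= 1)%N by rewrite c1.
  by move/(congr1 vC); rewrite vC1 sb_one0.
- move=> b /SE Sb; split; first exact: (@fsg_order _ (FiniteSubgroup cP)).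
  exact: (@fsg_order _ (FiniteSubgroup aP)).
move=> q pr_q q_dvd; have [c [c1 cq lc]] := cc q pr_q q_dvd.
exists (vC c); split.
- exact/SE/(fsvalP c).
- by move=> c0; case/eqP: c1; apply: vC_inj; rewrite c0 vC1 sb_one0.
- by rewrite -fsg_valX cq; exact: vC1.
- by have /(congr1 vA) := lc.
Qed.

(** * Skew braces with commutative multiplication *)

Section Ito.
Variables (B : skewBraceType) (D : set B) (Ds : sub_skew_brace D).
Hypothesis DC : forall a b, D a -> D b -> a ∘ b = b ∘ a.

Let lambdaC a b c : D a -> D b -> lambda a (lambda b c) = lambda b (lambda a c).
Proof. by move=> Da Db; rewrite !lambda_circ DC. Qed.

(* The translation by [v a b] is the commutator of the left multiplication by
   [a^-1] with [lambda] of the inverse of [b]. *)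
Let v a b : B := a - lambda b a.

Let lambda_v d a b : D b -> D d -> lambda d (v a b) = v (lambda d a) b.
Proof. by move=> Db Dd; rewrite /v lambdaD lambdaN lambdaC. Qed.

(** Conjugating a commutator by a left multiplication changes only the factor
    [lambda b], up to a left multiplication that commutes with the other factor;
    what matters is that [w] does not depend on [a]. *)
Let conj_v b c : D b -> D c -> exists2 w, D w &
  forall a, D a -> c + lambda c (v a b) - c = v a (b ∘ w).
Proof.
move=> Db Dc; have [e eE] : exists e, e = lambda b^-1 c by exists (lambda b^-1 c).
have De : D e by rewrite eE; apply: sub_lambda => //; apply: subV.
have Dw : D (c - e) by apply: subD => //; apply: subN.
exists (c - e) => // a Da.
have lw : lambda (c - e) a = e + lambda c a - lambda a e.
  rewrite lambdaE DC // sb_circD sb_circN [a ∘ c]DC //.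
  by rewrite !circ_lambda -!sb_addA !sb_simp -?sb_addA !sb_simp.
have lbw : lambda (b ∘ (c - e)) a = c + lambda c (lambda b a) - lambda a c.
  rewrite -lambda_circ lw (lambdaD b (e + _)) (lambdaD b e) lambdaN.
  rewrite [lambda b (lambda c a)]lambdaC // [lambda b (lambda a e)]lambdaC //.
  by rewrite eE !lambdaVK.
have addC : c + lambda c a = a + lambda a c by rewrite -!circ_lambda DC.
rewrite /v lbw lambdaD lambdaN sb_addA addC -!sb_addA !sb_oppD !sb_oppK.
by rewrite -!sb_addA.
Qed.

(** Ito's argument for products of two abelian groups, applied to the left
    multiplications and the maps [lambda]: conjugation of a commutator by a left
    multiplication and by some [lambda d] can be done in either order, since one
    changes only [b] and the other only [a]. *)
Lemma ito a b c d : D a -> D b -> D c -> D d ->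
  (a - lambda b a) + (c - lambda d c) = (c - lambda d c) + (a - lambda b a).
Proof.
move=> Da Db Dc Dd; rewrite -/(v a b).
have [c' c'E] : exists c', c' = - c by exists (- c).
have Dc' : D c' by rewrite c'E; apply: subN.
have -> : c - lambda d c = - c' + lambda d c' by rewrite c'E lambdaN sb_oppK.
have [w Dw wE] := conj_v Db Dc'.
pose a' := lambda d^-1 (lambda c'^-1 a).
have Da' : D a' by do 2![apply: sub_lambda => //; first exact: subV].
have Dda' : D (lambda d a') by apply: sub_lambda.
have Dbw : D (b ∘ w) by apply: subM.
have E1 : lambda c' (v (lambda d a') b) = v a b.
  by rewrite lambda_v // /a' !lambdaVK.
have := congr1 (lambda d) (wE a' Da').
rewrite [RHS]lambda_v // -wE // E1 (lambdaD d _ (- c')) (lambdaD d c') lambdaN.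
rewrite [lambda d (lambda c' _)]lambdaC // lambda_v // E1.
move: (lambda d c') (v a b) => L u /(congr1 (fun x => - c' + (x + L))).
by rewrite -!sb_addA !sb_simp => ->; rewrite !sb_addA.
Qed.

(* The centre of the centraliser of the elements [v a b], which contains these
   elements because they commute with each other. *)
Let S0 : set B := [set s | [/\ D s,
  forall a b, D a -> D b -> commute (s : addg B) (v a b) &
  forall t, D t -> (forall a b, D a -> D b -> commute (t : addg B) (v a b)) ->
    commute (s : addg B) t]].

Let S0_stable d s : D d -> S0 s -> S0 (lambda d s).
Proof.
have lc e x y : commute (x : addg B) y ->
    commute (lambda e x : addg B) (lambda e y).
  move=> C; change (lambda e x + lambda e y = lambda e y + lambda e x).
  by rewrite -!lambdaD; congr (lambda e _).
move=> Dd [Ds0 sv st].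
have DV : D d^-1 by apply: subV.
split; first exact: sub_lambda.
  move=> a b Da Db; rewrite -(lambdaVK d a) -lambda_v //.
  by apply/lc/sv => //; apply: sub_lambda.
move=> t Dt tv; rewrite -(lambdaVK d t); apply/lc/st; first exact: sub_lambda.
move=> a b Da Db; rewrite -(lambdaK d a) -lambda_v //.
by apply/lc/tv => //; apply: sub_lambda.
Qed.

(** If [lambda] is not trivial on [D], some [v a b] is nonzero and lies in the
    sub-skew brace [S0]. *)
Lemma circ_commutative_abelian :
  (forall a b, D a -> D b -> lambda a b = b) \/
  exists S, [/\ sub_skew_brace S, S `<=` D,
    forall a b, S a -> S b -> a + b = b + a & exists2 s, S s & s <> 0].
Proof.
have [all|] := pselect (forall a b, D a -> D b -> v a b = 0).
  left=> a b Da Db; apply: (@sb_addIr _ (- lambda a b)).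
  by rewrite sb_addN'; apply/esym/(all b a).
move=> /existsNP[a /existsNP[b /not_implyP[Da /not_implyP[Db vab]]]].
right; exists S0; split.
- apply: (@lambda_stable_sub _ _ D _ Ds.2 _ S0_stable); last by move=> x [].
  split.
  + split; first exact: sub0.
      by move=> *; apply/commute_sym/commute1.
    by move=> *; apply/commute_sym/commute1.
  + move=> x y [Dx xv xt] [Dy yv yt]; split; first exact: subD.
      by move=> a' b' Da' Db'; apply/commute_sym/commuteM; apply/commute_sym;
        [apply: xv | apply: yv].
    by move=> t Dt tv; apply/commute_sym/commuteM; apply/commute_sym;
      [apply: xt | apply: yt].
  + move=> x [Dx xv xt]; split; first exact: subN.
      by move=> a' b' Da' Db'; apply/commute_sym/commuteV/commute_sym/xv.
    by move=> t Dt tv; apply/commute_sym/commuteV/commute_sym/xt.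
- by move=> x [].
- by move=> x y [_ _ xt] [Dy yv _]; exact: xt.
exists (v a b) => //; split.
- by apply: subD => //; apply: subN => //; apply: sub_lambda.
- by move=> c d Dc Dd; exact: ito.
- by move=> t _ tv; apply/commute_sym/tv.
Qed.

End Ito.

(** * Infinite cyclic multiplicative groups *)

(** Bundled so that it can carry a structure of abelian group, to which
    [regular_affine_fix] applies. *)
Record commutative_sub (B : skewBraceType) := CommutativeSub {
  cs_set :> set B;
  cs_sub : sub_skew_brace cs_set;
  cs_comm : forall a b, cs_set a -> cs_set b -> a + b = b + a }.

Definition cs_type (B : skewBraceType) (D : commutative_sub B) : Type :=
  {x : B | x \in cs_set D}.

Section CommutativeSub.
Variables (B : skewBraceType) (D : commutative_sub B).

HB.instance Definition _ := Choice.on (cs_type D).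

Lemma cs_in (x : cs_type D) : cs_set D (val x).
Proof. by apply/set_mem/(valP x). Qed.

Definition cs_elt (x : B) (Dx : cs_set D x) : cs_type D := exist _ x (mem_set Dx).
Definition cs_zero : cs_type D := cs_elt (sub0 (cs_sub D)).
Definition cs_opp (x : cs_type D) := cs_elt (subN (cs_sub D) (cs_in x)).
Definition cs_add (x y : cs_type D) :=
  cs_elt (subD (cs_sub D) (cs_in x) (cs_in y)).

Lemma cs_addA : associative cs_add.
Proof. by move=> x y z; apply: val_inj; exact: sb_addA. Qed.
Lemma cs_addC : commutative cs_add.
Proof. by move=> x y; apply: val_inj; apply: cs_comm; exact: cs_in. Qed.
Lemma cs_add0 : left_id cs_zero cs_add.
Proof. by move=> x; apply: val_inj; exact: sb_add0. Qed.
Lemma cs_addN : left_inverse cs_zero cs_opp cs_add.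
Proof. by move=> x; apply: val_inj; exact: sb_addN. Qed.

HB.instance Definition _ :=
  GRing.isZmodule.Build (cs_type D) cs_addA cs_addC cs_add0 cs_addN.
End CommutativeSub.

(** Left multiplication by [x] is the affine map [b |-> x + lambda x b], and its
    powers act regularly. *)
Lemma abelian_infinite_cyclic_fixed (B : skewBraceType) (x : B) :
    sub_skew_brace (cyc x) -> ~ torsion x ->
    (forall a b, cyc x a -> cyc x b -> a + b = b + a) ->
  self_fixed x.
Proof.
move=> xs xoo xC; pose V : zmodType := cs_type (CommutativeSub xs xC).
have xl a b : cyc x a -> cyc x b -> cyc x (lambda a b) by exact: sub_lambda.
have xx := cyc_id x; have xV : cyc x x^-1 by apply: subV.
pose phi (y : V) : V := @cs_elt _ (CommutativeSub xs xC) _ (xl _ _ xx (cs_in y)).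
pose psi (y : V) : V := @cs_elt _ (CommutativeSub xs xC) _ (xl _ _ xV (cs_in y)).
have xz n : cyc x (zexp x n) by exists n.
pose s n : V := @cs_elt _ (CommutativeSub xs xC) _ (xz n).
pose a : V := @cs_elt _ (CommutativeSub xs xC) _ xx.
have : phi a = a.
  apply: (@regular_affine_fix V phi psi a s) => //.
  - by move=> y z; apply: val_inj; exact: lambdaD.
  - by move=> y; apply: val_inj; exact: lambdaK.
  - by move=> y; apply: val_inj; exact: lambdaVK.
  - by apply: val_inj; exact: sb_one0.
  - move=> n; apply: val_inj => /=; rewrite addrC zexpD zexp1.
    exact: circ_lambda.
  - by move=> m n /(congr1 val) /= /(zexp_inj xoo).
  - by move=> v; have [n _ nE] := cs_in v; exists n; apply: val_inj.
by move/(congr1 val).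
Qed.

(** Either [lambda] is trivial and [x] itself will do, or the multiplicative
    group of an additively commutative part is again infinite cyclic. *)
Lemma circ_infinite_cyclic_fixed (B : skewBraceType) (x : B) :
    sub_skew_brace (cyc x) -> ~ torsion x ->
  exists z, [/\ cyc x z, z <> 0 & self_fixed z].
Proof.
move=> xs xoo.
have x0 : x <> 0.
  by move=> x0; apply: xoo; exists 1%N; rewrite ?expg1 ?x0 ?sb_one0.
have xC a b : cyc x a -> cyc x b -> a ∘ b = b ∘ a.
  by move=> [m _ <-] [n _ <-]; rewrite -!zexpD addrC.
have [triv|[S [Ss Sx Sab [s Sn s0]]]] := circ_commutative_abelian xs xC.
  by exists x; split=> //; [exact: cyc_id | apply: triv; exact: cyc_id].
have [m SE] := subgroup_cyc Ss.2 Sx.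
have ym : ~ torsion (x ^+ m).
  move=> tm; apply: xoo; apply: (@torsion_sub_cyc _ x (x ^+ m)) => //.
    by exists m.
  move=> xm; apply: s0; move: Sn; rewrite SE xm => -[n _ <-].
  by rewrite zexp1n sb_one0.
exists (x ^+ m); split.
- by exists m.
- move=> m0; apply: ym; exists 1%N => //.
  by rewrite expg1 m0 sb_one0.
- by apply: abelian_infinite_cyclic_fixed; rewrite -?SE.
Qed.

(** * Elements of finite sub-skew braces *)

Section FiniteElements.
Variables (B : skewBraceType) (hB : Dedekind B).

(** The sum of two finite ideals is a finite ideal. *)
Lemma finite_elts_directed (E : set B) : finite_set E ->
  (forall y, E y -> finite_elt y) ->
  exists V, [/\ sub_skew_brace V, finite_set V & E `<=` V].
Proof.
move=> /finite_setP[n]; elim: n E => [|n IH] E.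
  rewrite II0 card_eq0 => /eqP -> _.
  by exists [set 0]; split=> //; exact: sub_set0.
move=> /eq_cardSP[y Ey En] EF.
have [V [Vs Vfin EV]] := IH _ En (fun z Ez => EF z Ez.1).
have [F [Fs Ffin Fy]] := EF y Ey.
exists (sum_set F V); split.
- by apply: sum_set_sub; apply: hB.
- exact: sum_set_finite.
move=> z Ez; have [->|zy] := pselect (z = y).
  by exists y, 0; split=> //; [exact: sub0 | rewrite sb_add0'].
by exists 0, z; split; [exact: sub0 | apply: EV | rewrite sb_add0].
Qed.

Lemma finite_elts_sub : sub_skew_brace (@finite_elt B).
Proof.
apply: directed_sub; first by exists [set 0]; split=> //; exact: sub_set0.
move=> x y fx fy; have [||V [Vs Vf VE]] := @finite_elts_directed [set x; y].
- exact: finite_set2.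
- by move=> z [->|->].
exists V; split=> //; [|by apply: VE; left|by apply: VE; right].
by move=> z Vz; exists V.
Qed.

Let T : ideal B := Ideal (hB finite_elts_sub).

(** Local finiteness is closed under extensions: the finitely many corrections
    needed to multiply representatives lie in a finite ideal [V], modulo which
    the representatives form a finite sub-skew brace. *)
Lemma finite_elt_ext (y : B) : finite_elt (qproj T y) -> finite_elt y.
Proof.
move=> [F [Fs Ffin Fy]].
pose r (b : B) : B := qrepr (qproj T b).
pose t b := - r b + b.
have tT b : finite_elt (t b).
  by apply/(qproj_eq T); rewrite /r qproj_repr.
pose R0 := @qrepr B T @` F.
have R0fin : finite_set R0 by exact: finite_image.
have rR0 b : F (qproj T b) -> R0 (r b) by exists (qproj T b).
have R0F b : R0 b -> F (qproj T b) by move=> [z Fz <-]; rewrite qproj_repr.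
pose E : set B := t @` ([set (0 : B)] `|` [set a + b | a in R0 & b in R0]
  `|` [set - a | a in R0] `|` [set a ∘ b | a in R0 & b in R0]
  `|` [set a^-1 | a in R0]).
have [|z [b _ <-] //|V [Vs Vfin EV]] := @finite_elts_directed E.
  apply: finite_image; rewrite !finite_setU; split; last exact: finite_image.
  split; last exact: finite_image2.
  split; last exact: finite_image.
  by split; [exact: finite_set1 | exact: finite_image2].
pose V' : ideal B := Ideal (hB Vs).
pose W := qproj V' @` R0.
have WI b : F (qproj T b) -> E (t b) -> W (qproj V' b).
  move=> Fb Etb; exists (r b); first exact: rR0.
  by apply/qproj_eq/EV.
have pM := qproj_morph T; have vM := qproj_morph V'.
have Ws : sub_skew_brace W.
  split; split.
  - rewrite -[1](sb_morph0 vM); apply: WI.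
      by rewrite (sb_morph0 pM); exact: sub0.
    by exists 0 => //; do 4!left.
  - move=> _ _ [a Ra <-] [b Rb <-]; rewrite -[_ * _](sb_morphD vM); apply: WI.
      by rewrite (sb_morphD pM); apply: subD => //; apply: R0F.
    by exists (a + b) => //; do 3!left; right; exists a => //; exists b.
  - move=> _ [a Ra <-]; rewrite -[_^-1](sb_morphN vM); apply: WI.
      by rewrite (sb_morphN pM); apply: subN => //; apply: R0F.
    by exists (- a) => //; do 2!left; right; exists a.
  - rewrite sb_one0 -(sb_morph0 vM); apply: WI.
      by rewrite (sb_morph0 pM); exact: sub0.
    by exists 0 => //; do 4!left.
  - move=> _ _ [a Ra <-] [b Rb <-]; rewrite -(sb_morphM vM); apply: WI.
      by rewrite (sb_morphM pM); apply: subM => //; apply: R0F.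
    by exists (a ∘ b) => //; left; right; exists a => //; exists b.
  - move=> _ [a Ra <-]; rewrite -(sb_morphV vM); apply: WI.
      by rewrite (sb_morphV pM); apply: subV => //; apply: R0F.
    by exists a^-1 => //; right; exists a.
have fr : finite_elt (r y).
  exists (qproj V' @^-1` W); split; first exact: (preimage_sub_brace vM).
    by apply: qproj_preimage_finite => //; apply: finite_image.
  by exists (r y) => //; apply: rR0.
rewrite -[y](sb_addNK (r y)); apply: (subD finite_elts_sub) => //.
exact: tT.
Qed.

(** If [y] is self-fixed modulo [T], then it is so modulo a finite ideal [F], and
    the maps [lambda (y ^+ i)] move [y] within a finite coset of [F].  Hence some
    [y ^+ m] fixes [y], and with it all the powers of [y]. *)
Lemma self_fixed_power (y : B) : self_fixed (qproj T y) ->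
  finite_elt y \/ exists m : nat, self_fixed (y ^+ m) /\ ~ torsion (y ^+ m).
Proof.
move=> fy; have [F [Fs Ffin Fu]] : finite_elt (- y + lambda y y).
  by apply/(qproj_eq T); rewrite (sb_morph_lambda (qproj_morph T)) fy.
pose F' : ideal B := Ideal (hB Fs); have fM := qproj_morph F'.
have fy' : self_fixed (qproj F' y).
  by rewrite /self_fixed -(sb_morph_lambda fM); apply/esym/qproj_eq.
have [[k k0 yk]|yoo] := pselect (torsion (qproj F' y)).
  left; exists (qproj F' @^-1` cyc (qproj F' y)); split.
  - exact/(preimage_sub_brace fM)/cyc_sub_skew_brace.
  - by apply: qproj_preimage_finite => //; apply: cyc_finite; exists k.
  - exact: cyc_id.
have [|i [j [ltij E]]] := @finite_repeat _ F (fun i => - y + lambda (y ^+ i) y) Ffin.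
  move=> i; apply/(qproj_eq F'); rewrite (sb_morph_lambda fM) (sb_morph_zexp fM y i).
  exact/esym/self_fixed_stab.
right; exists (j - i)%N.
have fixy : lambda (y ^+ (j - i)) y = y.
  apply: (@lambda_inj _ (y ^+ i)); rewrite lambda_circ -expgnDr subnKC ?(ltnW ltij) //.
  exact/esym/(sb_addI E).
split; last first.
  move=> [k k0 E']; apply: yoo; exists ((j - i) * k)%N.
    by rewrite muln_gt0 subn_gt0 ltij.
  have := sb_morph_zexp fM y ((j - i) * k)%N.
  by rewrite /= expgnA E' !sb_one0 (sb_morph0 fM) => <-.
suff H k : lambda (y ^+ (j - i)) (y ^+ k) = y ^+ k by exact: H.
elim: k => [|k IH]; first by rewrite expg0 sb_one0 lambda0.
have C : y ^+ (j - i) ∘ y = y ∘ y ^+ (j - i) by rewrite -expgS -expgSr.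
by rewrite expgS circ_lambda lambdaD fixy lambda_circ C -lambda_circ IH.
Qed.

End FiniteElements.

(** * Elements of prime order are central *)

(** An automorphism of a group of order [p] raises to the power [j]; by Fermat
    its [p ^ k]-th iterate raises to the power [j] as well. *)
Lemma prime_power_fixed (G : groupType) (c : G) (f : G -> G) (p k j : nat) :
    {morph f : x y / x * y} -> prime p -> c ^+ p = 1 -> f c = c ^+ j ->
  iter (p ^ k)%N f c = c -> f c = c.
Proof.
move=> fM pr_p cp fc E.
have fX x n : f (x ^+ n) = f x ^+ n by exact: (zexp_morph x n fM).
have itE n : iter n f c = c ^+ (j ^ n)%N.
  elim: n => [|n IH]; first by rewrite expn0 expg1.
  by rewrite iterS IH fX fc -expgnA expnS.
have cmod n : c ^+ (n %% p)%N = c ^+ n.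
  by rewrite [in RHS](divn_eq n p) expgnDr mulnC expgnA cp expg1n mul1g.
rewrite fc -[RHS]E itE -cmod -[RHS]cmod; congr (c ^+ _).
elim: k {E} => [|k IH]; first by rewrite expn0 expn1.
by rewrite expnSr expnM fermat_little.
Qed.

Section PrimeOrder.
Variables (G : groupType) (p : nat) (c : G).
Hypotheses (pr_p : prime p) (cp : c ^+ p = 1).

Lemma prime_order_nat y : cyc c y -> exists j : nat, y = c ^+ j.
Proof.
move=> [n _ <-]; exists `|(n %% p)%Z|%N.
have p0 : (p%:Z != 0)%R by have := prime_gt0 pr_p; lia.
have nE : n = (p%:Z * (n %/ p)%Z + `|(n %% p)%Z|%N%:Z)%R.
  by have := divz_eq n p; have := @modz_ge0 n p p0; lia.
by rewrite [in LHS]nE zexpD zexpM /= cp zexp1n mul1g.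
Qed.

Lemma coprime_exp_cyc (n : int) : coprimez n p -> cyc (zexp c n) c.
Proof.
move=> /coprimezP [[u w] /= E]; exists u => //.
have : zexp c (n * u + p%:Z * w)%R = c.
  by rewrite -[RHS]zexp1; congr (zexp c _); rewrite -E; lia.
by rewrite zexpD zexpM (zexpM c (Posz p)) zexp_nat cp zexp1n mulg1.
Qed.

Lemma prime_order_generated d : cyc c d -> d <> 1 -> cyc d c.
Proof.
move=> [n _ <-] d1; apply: coprime_exp_cyc.
rewrite coprimez_sym coprimezE prime_coprime //=; apply/negP => /dvdnP[m nE].
apply: d1; have [sn|sn] := lerP 0%R n.
  have -> : n = (p%:Z * m%:Z)%R by lia.
  by rewrite zexpM /= cp expg1n.
have -> : n = (p%:Z * - m%:Z)%R by lia.
by rewrite zexpM /= cp zexp1n.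
Qed.

Lemma prime_order_unique q : prime q -> c ^+ q = 1 -> c <> 1 -> q = p.
Proof.
move=> pr_q cq c1; apply/eqP; apply: contrapT => /negP qp; apply: c1.
have : cyc (zexp c q) c.
  by apply: coprime_exp_cyc; rewrite coprimezE /= prime_coprime // dvdn_prime2.
by rewrite zexp_nat cq => -[n _ <-]; rewrite zexp1n.
Qed.

End PrimeOrder.

Lemma iter_lambda (B : skewBraceType) (b x : B) n :
  iter n (lambda b) x = lambda (b ^+ n) x.
Proof.
elim: n => [|n IH]; first by rewrite expg0 lambda1.
by rewrite iterS IH lambda_circ -expgS.
Qed.

Lemma iter_conj (G : groupType) (b x : G) n :
  iter n (fun y => y ^ b) x = x ^ (b ^+ n).
Proof.
elim: n => [|n IH]; first by rewrite expg0 conjg1.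
by rewrite iterS IH -conjgM -expgSr.
Qed.

Section Monolith.
Variables (B : skewBraceType) (hB : Dedekind B) (tB : tame_quotients B).
Variables (p : nat) (c : B).
Hypotheses (pr_p : prime p) (cfix : self_fixed c) (c0 : c <> 0)
  (cp : c ^+ p = 1).
Hypothesis mono : forall S, sub_skew_brace S -> (exists2 s, S s & s <> 0) -> S c.

Let c1 : c <> 1. Proof. by rewrite sb_one0. Qed.

(** A self-fixed power of infinite order is impossible, as it would generate a
    torsion-free sub-skew brace without [c]. *)
Lemma monolith_finite (b : B) : finite_elt b.
Proof.
pose T : ideal B := Ideal (hB (finite_elts_sub hB)).
apply: contrapT => nb.
have [|y' y'0 ty] := tB (qproj_morph T) (qproj_surj T).
  by exists (qproj T b) => /qproj_eq0.
have [y yE] : exists y, qproj T y = y' by exists (qrepr y'); rewrite qproj_repr.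
have nfin : ~ finite_elt y by move=> fy; apply: y'0; rewrite -yE; apply/qproj_eq0.
rewrite -yE in ty; case: ty => [fy|fy].
  by apply: nfin; apply: finite_elt_ext fy.
have [//|[m [wfix woo]]] := self_fixed_power fy.
have ws := cyc_sub_skew_brace wfix.
have w0 : y ^+ m <> 0.
  by move=> w0; apply: woo; exists 1%N; rewrite // expg1 w0 sb_one0.
apply: woo; apply: (@torsion_sub_cyc _ _ c) => //; last first.
  by exists p => //; exact: prime_gt0.
by apply: mono => //; exists (y ^+ m); first exact: cyc_id.
Qed.

(** Any [b] lies in a finite sub-skew brace, whose order is a power of [p] by
    Cauchy's theorem.  The three actions of [b] on the group of order [p]
    generated by [c] then have order a power of [p], hence are trivial. *)
Lemma monolith_central : sb_center B c.
Proof.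
apply/sb_center_conjP => b; have [F [Fs Ffin Fb]] := monolith_finite b.
have [n [n0 n1 nE nq]] := finite_sub_Cauchy Fs Ffin.
have [k nk] : exists k, n = (p ^ k)%N.
  suff /p_natP[k nk] : p.-nat n by exists k.
  apply/pnatP => // q pr_q /(nq q pr_q) [d [Fd d0 dq dfix]].
  have /(prime_order_nat pr_q dq) [j cj] : cyc d c.
    by apply: mono; [exact: cyc_sub_skew_brace | exists d; first exact: cyc_id].
  rewrite !inE; apply/eqP; apply: (prime_order_unique pr_p cp pr_q) => //.
  by rewrite cj -expgnA mulnC expgnA dq expg1n.
have [bn bn'] := nE b Fb; rewrite nk in bn bn'.
have Cid := hB (cyc_sub_skew_brace cfix); have cc := cyc_id c.
have cX j : (c : addg B) ^+ j = c ^+ j :> B := self_fixed_zexp cfix j.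
have cp' : (c : addg B) ^+ p = 1 by rewrite [LHS]cX cp sb_one0.
have H f : {morph f : x y / x + y} -> cyc c (f c) ->
    iter (p ^ k)%N f c = c -> f c = c.
  move=> fD /(prime_order_nat pr_p cp) [j fj].
  apply: (@prime_power_fixed (addg B) c f p k j) => //.
  by rewrite fj; exact/esym/cX.
split.
- apply: H; [exact: lambdaD | exact: ideal_lambda|].
  by rewrite iter_lambda bn lambda1.
- apply: (H (fun x => - b + (x + b))).
  + by move=> x y; exact: (@conjMg (addg B) x y b).
  + exact: ideal_conjD.
  + have := @iter_conj (addg B) b c (p ^ k); rewrite bn' conjg1; exact.
- have [j cj] := prime_order_nat pr_p cp (ideal_conjM Cid b cc).
  apply: (@prime_power_fixed B c (fun x => x ^ b) p k j) => //.
  + by move=> x y; exact: conjMg.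
  + by rewrite iter_conj bn conjg1.
Qed.

End Monolith.

Section Central.
Variables (B : skewBraceType) (hB : Dedekind B) (tB : tame_quotients B).

Lemma maximal_sub_avoiding (c : B) : c <> 0 -> exists N, [/\ sub_skew_brace N,
  ~ N c & forall S, sub_skew_brace S -> N `<=` S -> ~ S `<=` N -> S c].
Proof.
move=> c0; pose P (S : set B) := sub_skew_brace (S `|` [set 0]) /\ ~ S c.
(* Adding [0] makes the empty chain have an upper bound. *)
have [|A [[As Ac] maxA]] := @Zorn_bigcup B P.
  move=> F FP totF; split; last by move=> [X FX Xc]; have [] := FP _ FX.
  pose U := \bigcup_(X in F) X.
  have up X : F X -> sub_skew_brace (X `|` [set 0]) /\
      X `|` [set 0] `<=` U `|` [set 0].
    move=> FX; split; first by have [] := FP _ FX.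
    by move=> z [Xz|->]; [left; exists X | right].
  apply: directed_sub; first by right.
  move=> x y [[X FX Xx]|->] [[Y FY Yy]|->].
  + have [XY|YX] := totF _ _ FX FY.
      exists (Y `|` [set 0]); have [? ?] := up _ FY.
      by split=> //; left=> //; exact: XY.
    exists (X `|` [set 0]); have [? ?] := up _ FX.
    by split=> //; left=> //; exact: YX.
  + by exists (X `|` [set 0]); have [? ?] := up _ FX; split=> //; [left|right].
  + by exists (Y `|` [set 0]); have [? ?] := up _ FY; split=> //; [right|left].
  + by exists [set 0]; split; [exact: sub_set0 | move=> z ->; right | |].
exists (A `|` [set 0]); split=> //; first by case.
move=> S Ss AS SA; apply: contrapT => Sc.
have S0 : S `|` [set 0] = S.
  by apply/seteqP; split=> [x [//|->]|x]; [exact: sub0 | left].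
apply: (maxA S); last by split; rewrite ?S0.
by split=> [x Ax|SA']; [apply: AS; left | apply: SA => x /SA'; left].
Qed.

(** Being fixed by [b] can be tested modulo [N], since [N] meets the ideal of
    order [p] generated by [c] trivially. *)
Lemma prime_order_central (p : nat) (c : B) : prime p -> self_fixed c ->
  c <> 0 -> c ^+ p = 1 -> sb_center B c.
Proof.
move=> pr_p cfix c0 cp; have [N [Ns Nc Nmax]] := maximal_sub_avoiding c0.
pose N' : ideal B := Ideal (hB Ns); have pM := qproj_morph N'.
have : sb_center (quot_brace N') (qproj N' c).
  apply: (monolith_central (quot_Dedekind hB) (quot_tame tB) pr_p).
  - by rewrite /self_fixed -(sb_morph_lambda pM) cfix.
  - by move=> /qproj_eq0.
  - by have := sb_morph_zexp pM c p; rewrite /= cp !sb_one0 (sb_morph0 pM) => <-.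
  move=> S Ss [s Sn s0]; apply: (Nmax (qproj N' @^-1` S)).
  - exact: (preimage_sub_brace pM).
  - by move=> x /(@qproj_eq0 _ N') E; rewrite /preimage /= E; exact: sub0.
  - move=> SN; apply: s0; rewrite -(qproj_repr s); apply/qproj_eq0/SN.
    by rewrite /preimage /= qproj_repr.
have Cs := cyc_sub_skew_brace cfix; have Cid := hB Cs; have cc := cyc_id c.
have NC x : cyc c x -> qproj N' x = qproj N' c -> x = c.
  move=> cx /esym/qproj_eq Nx; apply: (@sb_addI _ (- c)); rewrite sb_addN.
  apply: contrapT => x0; apply: Nc; apply: (cyc_sub Ns.2 Nx).
  apply: (prime_order_generated pr_p cp); last by rewrite sb_one0.
  by apply: (subD Cs) => //; exact: subN.
move=> /sb_center_conjP Zc; apply/sb_center_conjP => b.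
have [Lb Ab Mb] := Zc (qproj N' b); split; apply: NC.
- exact: ideal_lambda.
- by rewrite (sb_morph_lambda pM).
- exact: ideal_conjD.
- by rewrite (sb_morph_conjD pM).
- exact: ideal_conjM.
- by rewrite (sb_morph_conjM pM).
Qed.

Lemma finite_sub_central (S : set B) : sub_skew_brace S -> finite_set S ->
    (exists2 s, S s & s <> 0) ->
  exists c q, [/\ S c, c <> 0, sb_center B c, prime q & c ^+ q = 1].
Proof.
move=> Ss Sfin [s Sn s0]; have [n [n0 n1 _ nq]] := finite_sub_Cauchy Ss Sfin.
have n_gt1 : (1 < n)%N.
  by rewrite ltn_neqAle n0 andbT; apply/eqP => /esym/n1/(_ s Sn).
have [c [Sc c0 cq cfix]] := nq _ (pdiv_prime n_gt1) (pdiv_dvd n).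
exists c, (pdiv n); split=> //; last exact: pdiv_prime.
exact: prime_order_central (pdiv_prime n_gt1) cfix c0 cq.
Qed.

End Central.

(** * Infinite cyclic ideals are central *)

(** The only automorphisms of an infinite cyclic group are the identity and the
    inversion, since [f] and its inverse [f'] raise to integer powers with
    product [1]. *)
Lemma infinite_cyclic_pm (G : groupType) (g : G) (f f' : G -> G) :
    ~ torsion g -> {morph f : x y / x * y} -> {morph f' : x y / x * y} ->
  cyc g (f g) -> cyc g (f' g) -> f' (f g) = g -> f g = g \/ f g = g^-1.
Proof.
move=> goo fM f'M [n _ nE] [m _ mE] ff'.
have nm : (n * m = 1)%R.
  apply: (zexp_inj goo); rewrite mulrC zexpM mE -(zexp_morph _ _ f'M) nE ff'.
  by rewrite zexp1.
have : (`|n| * `|m|)%N == 1%N by rewrite -abszM nm.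
rewrite muln_eq1 => /andP[/eqP n1 _]; rewrite -nE.
have [->|->] : (n = 1 \/ n = -1)%R by lia.
  by left; rewrite zexp1.
by right; rewrite zexpN zexp1.
Qed.

(** The inversion does not fix a generator modulo cubes. *)
Lemma infinite_cyclic_fixed (G : groupType) (g : G) (f f' : G -> G) :
    ~ torsion g -> {morph f : x y / x * y} -> {morph f' : x y / x * y} ->
    cyc g (f g) -> cyc g (f' g) -> f' (f g) = g ->
  cyc (zexp g 3) (g^-1 * f g) -> f g = g.
Proof.
move=> goo fM f'M fg f'g ff' [t _ tE].
have [//|E] := infinite_cyclic_pm goo fM f'M fg f'g ff'.
have : (3 * t = - 2)%R; last by lia.
by apply: (zexp_inj goo); rewrite zexpM tE E /= expg2 invgM.
Qed.

Section Central.
Variables (B : skewBraceType) (hB : Dedekind B) (tB : tame_quotients B).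

(** Modulo the ideal [N] of triples the group is finite, so it has a central
    element of prime order; that element is a generator of the group of order
    [3], whose elements are therefore central modulo [N]. *)
Lemma add_cyclic_central (g : B) : is_ideal (cyc (g : addg B) : set B) ->
  ~ torsion (g : addg B) -> cyc (g : addg B) `<=` sb_center B.
Proof.
move=> Jid goo; have Js := ideal_sub Jid; have gJ : cyc (g : addg B) g := cyc_id _.
pose h : addg B := zexp (g : addg B) 3.
have hJ : cyc (g : addg B) h by exists 3%R.
have Ns : sub_skew_brace (cyc h : set B).
  apply: (@lambda_stable_sub _ _ setT) => //; first exact: cyc_subgroup.
  move=> d _ _ [n _ <-]; rewrite lambda_zexp.
  have [m _ mE] := ideal_lambda Jid d gJ.
  exists (m * n)%R => //.
  by rewrite /h lambda_zexp -mE -!zexpM; congr (zexp _ _); lia.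
pose N : ideal B := Ideal (hB Ns); have pM := qproj_morph N.
pose q : quot_brace N := qproj N g.
have q3 : zexp (q : addg (quot_brace N)) 3 = 1.
  rewrite -[LHS](sb_morph_azexp pM); apply/qproj_eq0; exact: cyc_id.
have q0 : q <> 0.
  move=> /qproj_eq0 [n _ nE]; have := @zexp_inj _ _ goo (3 * n)%R 1%R.
  by rewrite zexp1 zexpM => /(_ nE); lia.
have JE x : cyc (g : addg B) x -> cyc (q : addg (quot_brace N)) (qproj N x).
  by move=> [n _ <-]; exists n; rewrite ?(sb_morph_azexp pM).
have [|||c [r [[x Jx xE] c0 Zc _ _]]] := @finite_sub_central _ (quot_Dedekind hB)
    (quot_tame tB) (qproj N @` (cyc (g : addg B) : set B)).
- exact: (image_sub_brace pM Js).
- apply: (@sub_finite_set _ _ (cyc (q : addg (quot_brace N)))).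
    by move=> _ [x Jx <-]; exact: JE.
  by apply: cyc_finite; exists 3%N.
- by exists q => //; exists g.
have [m _ mE] := JE x Jx; rewrite xE in mE.
have Zq : sb_center _ q.
  have [e eE] : exists e : int, exists t : int, (m * e = 1 + 3 * t)%R.
    have [m0|[m1|m2]] : (m %% 3 = 0)%Z \/ (m %% 3 = 1)%Z \/ (m %% 3 = 2)%Z by lia.
    - case: c0; rewrite -mE; have -> : m = (3 * (m %/ 3)%Z)%R by lia.
      by rewrite zexpM q3 zexp1n.
    - by exists 1%R, (m %/ 3)%Z; lia.
    - by exists (-1)%R, (- (m %/ 3)%Z - 1)%R; lia.
  have [t tE] := eE.
  have -> : q = zexp (c : addg (quot_brace N)) e.
    by rewrite -mE -zexpM tE zexpD zexp1 zexpM q3 zexp1n [RHS]mulg1.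
  exact: (@subgroup_zexp (addg (quot_brace N)) _ c e (sb_center_sub _).1 Zc).
have {}Zq b := (sb_center_conjP q).1 Zq (qproj N b).
have lam b : lambda b g = g.
  apply: (@infinite_cyclic_fixed (addg B) g (lambda b) (lambda b^-1)) => //.
  - exact: lambdaD.
  - exact: lambdaD.
  - exact: ideal_lambda.
  - exact: ideal_lambda.
  - exact: lambdaK.
  - have [Lb _ _] := Zq b; apply/(@qproj_eq _ N).
    by rewrite (sb_morph_lambda pM).
have gfix : self_fixed g by exact: lam.
have addc b : - b + (g + b) = g.
  apply: (@infinite_cyclic_fixed (addg B) g (fun x => - b + (x + b))
    (fun x => b + (x - b))) => //.
  - by move=> u v; exact: (@conjMg (addg B)).
  - by move=> u v; have := @conjMg (addg B) u v (- b : B); rewrite /conjg !invgK.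
  - exact: ideal_conjD.
  - by have := ideal_conjD Jid (- b) gJ; rewrite sb_oppK.
  - by rewrite -!sb_addA !sb_simp.
  - have [_ Ab _] := Zq b; apply/(@qproj_eq _ N).
    by rewrite (sb_morph_conjD pM).
have cE : cyc (g : addg B) = cyc g :> set B := self_fixed_cyc_add gfix.
have goo' : ~ torsion g by move/(self_fixed_torsion gfix).
have mulc b : g ^ b = g.
  apply: (@infinite_cyclic_fixed B g (fun x => x ^ b) (fun x => x ^ b^-1)) => //.
  - by move=> u v; exact: conjMg.
  - by move=> u v; exact: conjMg.
  - by rewrite -cE; apply: ideal_conjM.
  - by rewrite -cE; apply: ideal_conjM.
  - exact: conjgK.
  - have [_ _ Mb] := Zq b.
    have /qproj_circ_eq [n _ nE] : qproj N g = qproj N (g ^ b).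
      by rewrite (sb_morph_conjM pM).
    exists n => //; rewrite -nE /h -!zexpM; exact/esym/self_fixed_zexp.
by apply: (cyc_sub (sb_center_sub B).1); apply/sb_center_conjP.
Qed.

Lemma self_fixed_central (g : B) : self_fixed g -> ~ torsion g -> sb_center B g.
Proof.
move=> gfix goo; apply: add_cyclic_central; last exact: cyc_id.
  by rewrite (self_fixed_cyc_add gfix); exact/hB/cyc_sub_skew_brace.
by move/(self_fixed_torsion gfix).
Qed.

(** For central [w = v^-1 * f v], the [q]-th power of [f v] is
    [v ^+ q * w ^+ q]. *)
Lemma torsion_commutator (G : groupType) (f : G -> G) (v : G) (q : nat) :
    {morph f : x y / x * y} -> commute v (v^-1 * f v) -> (0 < q)%N ->
  f (v ^+ q) = v ^+ q -> torsion (v^-1 * f v).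
Proof.
move=> fM C q0 fq; exists q => //; apply: (mulgI (v ^+ q)).
by rewrite -expgMn // mulVKg mulg1 -[RHS]fq [RHS](zexp_morph v q fM).
Qed.

(** Let [W] be the central part of [cyc x]; it is nonzero.  If it were proper,
    some [v] outside [W] would be central of prime order [q] modulo [W], hence
    moved by each automorphism by some [w] in [W]; as the automorphism fixes the
    [q]-th power of [v], which lies in [W], the element [w] has finite order. *)
Lemma circ_cyclic_central (x : B) : is_ideal (cyc x) -> ~ torsion x ->
  cyc x `<=` sb_center B.
Proof.
move=> Jid xoo; have Js := ideal_sub Jid.
have [z [Jz z0 zfix]] := circ_infinite_cyclic_fixed Js xoo.
have Joo y : cyc x y -> y <> 0 -> ~ torsion y.
  move=> Jy y0 ty; apply: xoo; apply: (torsion_sub_cyc Jy) => //.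
  by rewrite sb_one0.
have Zz : sb_center B z by apply: self_fixed_central => //; exact: Joo.
have Ws := setI_sub (sb_center_sub B) Js.
pose W : ideal B := Ideal (hB Ws); have pM := qproj_morph W.
have [m WE] : exists m : nat, sb_center B `&` cyc x = cyc (x ^+ m).
  by apply: subgroup_cyc; [exact: Ws.2 | move=> y []].
have m0 : (0 < m)%N.
  rewrite lt0n; apply/eqP => m0; apply: z0.
  have : (sb_center B `&` cyc x) z by [].
  by rewrite WE m0 expg0 => -[n _ <-]; rewrite zexp1n sb_one0.
apply: (cyc_sub (sb_center_sub B).2); apply: contrapT => xZ.
have [|||c [q [[v Jv vE] c0 Zc pr_q cq]]] := @finite_sub_central _ (quot_Dedekind hB)
    (quot_tame tB) (qproj W @` (cyc x)).
- exact: (image_sub_brace pM Js).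
- apply: (@sub_finite_set _ _ (cyc (qproj W x))).
    by move=> _ [_ [n _ <-] <-]; exists n; rewrite ?(sb_morph_zexp pM).
  apply: cyc_finite; exists m => //.
  rewrite -[LHS](sb_morph_zexp pM x m) sb_one0; apply/qproj_eq0.
  rewrite -[ideal_set W]/(sb_center B `&` cyc x) WE; exact: cyc_id.
- exists (qproj W x); first by exists x => //; exact: cyc_id.
  by move=> /qproj_eq0 [].
have cfix := center_self_fixed Zc.
apply: c0; rewrite -vE; apply/qproj_eq0; split=> //.
have q0 := prime_gt0 pr_q.
have Zvq : sb_center B (v ^+ q).
  have /qproj_eq0 [] // : qproj W (v ^+ q) = 0.
  by rewrite (sb_morph_zexp pM v q) vE /= cq sb_one0.
have Zqv : sb_center B ((v : addg B) ^+ q).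
  have /qproj_eq0 [] // : qproj W ((v : addg B) ^+ q) = 0.
  by rewrite (sb_morph_azexp pM v q) vE (self_fixed_zexp cfix) /= cq sb_one0.
have Wtf y : ideal_set W y -> torsion (y : addg B) -> y = 0.
  move=> [Zy Jy] ty; apply: contrapT => /(Joo y Jy); apply.
  exact/(self_fixed_torsion (center_self_fixed Zy)).
apply/sb_center_conjP => b.
have [Lb Ab Mb] := (sb_center_conjP c).1 Zc (qproj W b).
have comA y : ideal_set W y -> commute (v : addg B) y.
  by move=> [/sb_centerP Zy _]; have [_ Ay _] := Zy v; exact: Ay.
have [Lq Aq _] := (sb_center_conjP _).1 Zqv b.
have [_ _ Mq] := (sb_center_conjP _).1 Zvq b.
split.
- have Wy : ideal_set W (- v + lambda b v).
    by apply/qproj_eq; rewrite (sb_morph_lambda pM) vE Lb.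
  apply: (@sb_addI _ (- v)); rewrite sb_addN; apply: Wtf => //.
  apply: (@torsion_commutator (addg B) (lambda b) v q) => //.
    exact: lambdaD.
  exact: comA.
- have Wy : ideal_set W (- v + (- b + (v + b))).
    by apply/qproj_eq; rewrite (sb_morph_conjD pM) vE Ab.
  apply: (@sb_addI _ (- v)); rewrite sb_addN; apply: Wtf => //.
  apply: (@torsion_commutator (addg B) (fun y => - b + (y + b)) v q) => //.
    by move=> y y'; exact: (@conjMg (addg B)).
  exact: comA.
- have Wy : ideal_set W (v^-1 ∘ v ^ b).
    by apply/qproj_circ_eq; rewrite (sb_morph_conjM pM) vE Mb.
  apply: (mulgI v^-1); rewrite mulVg sb_one0; apply: Wtf => //.
  apply/(self_fixed_torsion (center_self_fixed Wy.1)).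
  apply: (@torsion_commutator B (fun y => y ^ b) v q) => //.
    by move=> y y'; exact: conjMg.
  by have [/sb_centerP Zy _] := Wy; have [_ _ My] := Zy v; exact: My.
Qed.

Lemma center_nontrivial : (exists y : B, y <> 0) ->
  exists2 c, sb_center B c & c <> 0.
Proof.
move=> ex; have idM : sb_morph (@id B) by [].
have [|//|y y0 ty] := tB idM; first by apply/seteqP; split=> // x _; exists x.
have fin F : sub_skew_brace F -> finite_set F -> F y ->
    exists2 c, sb_center B c & c <> 0.
  move=> Fs Ff Fy; have [|c [q [_ c0 Zc _ _]]] := finite_sub_central hB tB Fs Ff.
    by exists y.
  by exists c.
case: ty => [[F [Fs Ff Fy]]|yfix]; first exact: fin Fy.
have [ty|yoo] := pselect (torsion y); last first.
  by exists y; first exact: self_fixed_central.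
by apply: fin (cyc_id y); [exact: cyc_sub_skew_brace | exact: cyc_finite].
Qed.

(** The elements of infinite order are central, and an element of finite order is
    the difference of two such elements. *)
Lemma trivial_nonperiodic_central (X : set B) : sub_skew_brace X ->
  trivial_on X -> ~ periodic (X : set (addg B)) -> X `<=` sb_center B.
Proof.
move=> Xs Xt /existsNP [x /not_implyP [Xx xoo]].
have fix_ y : X y -> self_fixed y.
  by move=> Xy; rewrite /self_fixed lambdaE -Xt // sb_addKN.
have oo y : X y -> ~ torsion (y : addg B) -> sb_center B y.
  move=> Xy yoo; apply: self_fixed_central; first exact: fix_.
  by move/(self_fixed_torsion (fix_ y Xy)).
have Zx := oo x Xx xoo.
move=> y Xy; have [[l l0 yl]|yoo] := pselect (torsion (y : addg B)); last exact: oo.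
have [_ Axy _] := (sb_centerP x).1 Zx y.
rewrite -[y](sb_addKN x); apply: (subD (sb_center_sub B)).
  exact/(subN (sb_center_sub B)).
apply: oo; first exact: subD.
move=> [k k0 E]; apply: xoo; exists (k * l)%N; first by rewrite muln_gt0 k0.
have C : commute (x : addg B) y by exact/esym/Axy.
have ykl : (y : addg B) ^+ (k * l) = 1 by rewrite mulnC expgnA yl expg1n.
have xykl : (x + y : addg B) ^+ (k * l) = 1 by rewrite expgnA E expg1n.
by have := expgMn (k * l) C; rewrite ykl mulg1 => <-.
Qed.

End Central.

(** * From the ascending series to tame quotients *)

(** Each [u] acts on the group by a sign, and fixes itself when the sign is
    positive.  If it is negative for both [g] and [g + g], then it is positive
    for their quotient. *)
Lemma add_infinite_cyclic_fixed (B : skewBraceType) (g : B) :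
    sub_skew_brace (cyc (g : addg B) : set B) -> ~ torsion (g : addg B) ->
  exists z, [/\ cyc (g : addg B) z, z <> 0 & self_fixed z].
Proof.
move=> Js goo; have Jg : cyc (g : addg B) g := cyc_id _.
have pm (u : B) : cyc (g : addg B) u -> lambda u g = g \/ lambda u g = - g.
  move=> Ju; apply: (@infinite_cyclic_pm (addg B) g (lambda u) (lambda u^-1)) => //.
  - exact: lambdaD.
  - exact: lambdaD.
  - exact: (sub_lambda Js).
  - by apply: (sub_lambda Js) => //; exact: (subV Js).
  - exact: lambdaK.
have fixJ (u : B) : cyc (g : addg B) u -> lambda u g = g -> self_fixed u.
  by move=> [n _ <-] E; rewrite /self_fixed lambda_zexp E.
have J2 : cyc (g : addg B) (g + g) := subD Js Jg Jg.
have g0 : g <> 0 by move=> g0; apply: goo; exists 1%N.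
have gg0 : g + g <> 0 by move=> E; apply: goo; exists 2%N.
have [E|E1] := pm g Jg; first by exists g; split=> //; exact: fixJ.
have [E|E2] := pm _ J2; first by exists (g + g); split=> //; exact: fixJ.
have Jz : cyc (g : addg B) ((g + g) ∘ g^-1) by apply: (subM Js) => //; exact: subV.
exists ((g + g) ∘ g^-1); split=> //; last apply: fixJ => //.
  move=> E; apply: g0; apply: (@sb_addI _ g); rewrite sb_add0'.
  by apply: (mulIg g^-1); rewrite E mulgV sb_one0.
rewrite -lambda_circ; have -> : lambda g^-1 g = - g.
  by apply: (@lambda_inj _ g); rewrite lambdaVK lambdaN E1 sb_oppK.
by rewrite lambdaN E2 sb_oppK.
Qed.

Section WellOrder.
Variables (A : Type) (R : rel A) (woR : wochoice.well_order R).

Lemma wo_min (P : A -> Prop) : (exists a, P a) ->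
  exists2 m, P m & forall x, P x -> R m x.
Proof.
move=> [a Pa]; have [|m [[/asboolP Pm Rm] _]] := woR (A := fun x => `[< P x >]).
  by exists a; apply/asboolP.
by exists m => // x Px; apply: Rm; apply/asboolP.
Qed.

Lemma wo_total a b : R a b \/ R b a.
Proof.
have [|m [->|->] H] := @wo_min (fun x => x = a \/ x = b); first by exists a; left.
  by left; apply: H; right.
by right; apply: H; left.
Qed.

Lemma wo_anti a b : R a b -> R b a -> a = b.
Proof.
move=> Rab Rba; pose P x := `[< x = a \/ x = b >].
have Pa : P a by apply/asboolP; left.
have Pb : P b by apply/asboolP; right.
have refl x : R x x by case: (wo_total x x).
have [|m [_ mu]] := woR (A := P); first by exists a.
have ma : m = a by apply: mu; split=> // x /asboolP[->|->].
have mb : m = b by apply: mu; split=> // x /asboolP[->|->].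
by rewrite -ma.
Qed.

Lemma wo_trans a b c : R a b -> R b c -> R a c.
Proof.
move=> Rab Rbc.
have [|m [->|[->|->]] H] := @wo_min (fun x => x = a \/ x = b \/ x = c).
- by exists a; left.
- by apply: H; right; right.
- have -> : a = b by apply: wo_anti => //; apply: H; left.
  exact: Rbc.
- have Rca : R c a by apply: H; left.
  have Rcb : R c b by apply: H; right; left.
  by have <- : b = c by exact: wo_anti.
Qed.

Lemma wo_ltNle a b : idx_lt R a b <-> ~ R b a.
Proof.
split=> [[Rab ab] Rba|Rba]; first exact/ab/wo_anti.
have [Rab|//] := wo_total a b; split=> // ab.
by apply: Rba; rewrite ab in Rab *.
Qed.

Lemma wo_lt_le_trans a b c : idx_lt R a b -> R b c -> idx_lt R a c.
Proof.
move=> /wo_ltNle Rba Rbc; apply/wo_ltNle => Rca.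
by apply: Rba; apply: wo_trans Rca.
Qed.

Lemma wo_ind (P : A -> Prop) :
  (forall a, (forall b, idx_lt R b a -> P b) -> P a) -> forall a, P a.
Proof.
move=> H a; apply: contrapT => Pa.
have [|m Pm min] := @wo_min (fun x => ~ P x); first by exists a.
apply: Pm; apply: H => b /wo_ltNle Rmb; apply: contrapT => Pb.
exact/Rmb/min.
Qed.

End WellOrder.

Lemma smallest_sub_brace (B : skewBraceType) (F : set B) :
  sub_skew_brace (smallest (@sub_skew_brace B) F).
Proof.
split; split.
- by move=> S [Ss _]; exact: sub0.
- by move=> x y Hx Hy S HS; apply: (subD HS.1); [exact: Hx | exact: Hy].
- by move=> x Hx S HS; apply: (subN HS.1); exact: Hx.
- by move=> S [Ss _]; rewrite sb_one0; exact: sub0.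
- by move=> x y Hx Hy S HS; apply: (subM HS.1); [exact: Hx | exact: Hy].
- by move=> x Hx S HS; apply: (subV HS.1); exact: Hx.
Qed.

(** For a nonzero image of [B], the least term of the series outside the kernel
    is a successor, so that its image is a nonzero quotient of a factor. *)
Lemma series_tame_quotients (B : skewBraceType) (A : Type) (R : rel A)
    (I : A -> ideal B) : ascending_series R I ->
    (forall a b : A, idx_succ R a b ->
       [\/ locally_finite (ideal_factor (I b) (I a)),
           cyclic_subgroup
             (ideal_factor (I b) (I a) : set (addg (quot_brace (I a))))
         | cyclic_subgroup (ideal_factor (I b) (I a) : set (quot_brace (I a)))]) ->
  tame_quotients B.
Proof.
move=> [[woR mono Izero Ilim] [top _ Itop]] fac B' f fM fT [y0 y0n].
have [a [x Ix fx] a_min] : exists2 a, (exists2 x, ideal_set (I a) x & f x <> 0) &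
    forall b, (exists2 x, ideal_set (I b) x & f x <> 0) -> R a b.
  apply: (wo_min woR); exists top.
  have [x _ xE] : range f y0 by rewrite fT.
  by exists x; rewrite ?Itop // xE.
have Iker b : idx_lt R b a -> forall z, ideal_set (I b) z -> f z = 0.
  move=> /(wo_ltNle woR) Rab z Iz; apply: contrapT => fz; apply: Rab.
  by apply: a_min; exists z.
have [b sba] : exists b, idx_succ R b a.
  apply: contrapT => /forallNP nsucc; apply: fx.
  have [za|nza] := pselect (idx_zero R a).
    by move: Ix; rewrite (Izero a za) => ->; exact: sb_morph0 fM.
  by move: Ix; rewrite (Ilim a) // => -[b ltba]; exact: Iker.
have [gM gE] := quot_lift fM (Iker b sba.1).
pose g : quot_brace (I b) -> B' := f \o @qrepr B (I b).
have Is := ideal_sub (idealP (I a)); have pM := qproj_morph (I b).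
have Fs : sub_skew_brace (ideal_factor (I a) (I b)) := image_sub_brace pM Is.
have Fx : ideal_factor (I a) (I b) (qproj (I b) x) by exists x.
have gx : g (qproj (I b) x) = f x by exact: gE.
have fin S : sub_skew_brace S -> finite_set S -> S (qproj (I b) x) ->
    exists2 y : B', y <> 0 & tame y.
  move=> Ss Sfin Sx; exists (f x) => //; left; exists (g @` S); split.
  - exact: (@image_sub_brace _ _ g gM _ Ss).
  - exact: finite_image.
  - by exists (qproj (I b) x).
have [lf|/cyclic_subgroupP[c cE]|/cyclic_subgroupP[c cE]] := fac b a sba.
- have Ss := smallest_sub_brace [set qproj (I b) x].
  apply: (fin _ Ss); last by move=> S [_ /(_ _ erefl)].
  apply: lf; [exact: Ss | | by exists [set qproj (I b) x]].
  by move=> z; apply; split=> // _ ->.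
- have FgE : g @` ideal_factor (I a) (I b) = cyc (g c : addg B').
    rewrite cE; apply/seteqP; split=> [_ [_ [n _ <-] <-]|_ [n _ <-]].
      by exists n => //; exact/esym/(sb_morph_azexp gM).
    exists (zexp (c : addg _) n); first by exists n.
    exact: (sb_morph_azexp gM).
  have Ds := @image_sub_brace _ _ g gM _ Fs; rewrite FgE in Ds.
  have [tc|coo] := pselect (torsion (g c : addg B')).
    exists (f x) => //; left; exists (cyc (g c : addg B')).
    split; [exact: Ds | exact: cyc_finite tc |].
    by rewrite -FgE -gx; exists (qproj (I b) x).
  by have [z [_ z0 zfix]] := add_infinite_cyclic_fixed Ds coo; exists z => //; right.
have FgE : g @` ideal_factor (I a) (I b) = cyc (g c).
  rewrite cE; apply/seteqP; split=> [_ [_ [n _ <-] <-]|_ [n _ <-]].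
    by exists n => //; exact/esym/(sb_morph_zexp gM).
  by exists (zexp c n); [exists n | exact: (sb_morph_zexp gM)].
have Ds := @image_sub_brace _ _ g gM _ Fs; rewrite FgE in Ds.
have [tc|coo] := pselect (torsion (g c)).
  exists (f x) => //; left; exists (cyc (g c)).
  split; [exact: Ds | exact: cyc_finite tc |].
  by rewrite -FgE -gx; exists (qproj (I b) x).
by have [z [_ z0 zfix]] := circ_infinite_cyclic_fixed Ds coo; exists z => //; right.
Qed.

(** * The upper central series *)

Section Hypercentral.
Variables (B : skewBraceType) (A : Type) (R : rel A).

(** For an ideal [N], the preimage of the centre of the quotient by [N]; as a
    formula in a mere set it can be used before [N] is known to be an ideal. *)
Definition next_center (N : set B) : set B := [set x | forall c,
  [/\ N (- x + lambda c x), N (- x + (- c + (x + c))) & N (- x + x ^ c)]].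

(** [ucs a] is the union of the [next_center (ucs b)] for [b] below [a], a
    formula that covers zero, successor and limit indices alike. *)
Inductive ucs : A -> B -> Prop :=
| Ucs0 a : ucs a 0
| UcsS a b x : idx_lt R b a ->
    (forall c, ucs b (- x + lambda c x)) ->
    (forall c, ucs b (- x + (- c + (x + c)))) ->
    (forall c, ucs b (- x + x ^ c)) -> ucs a x.

Lemma ucsP a x :
  ucs a x <-> x = 0 \/ exists2 b, idx_lt R b a & next_center (ucs b) x.
Proof.
split=> [|[->|[b ltba xb]]]; last 2 first.
- exact: Ucs0.
- by apply: (UcsS ltba) => c; have [] := xb c.
case=> [a'|a' b x' ltb L D M]; first by left.
by right; exists b => // c; split.
Qed.

Lemma next_center_mono (N M : set B) : N `<=` M -> next_center N `<=` next_center M.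
Proof. by move=> NM x Nx c; have [L D E] := Nx c; split; apply: NM. Qed.

Lemma next_centerE (N : ideal B) :
  next_center N = qproj N @^-1` sb_center (quot_brace N).
Proof.
have pM := qproj_morph N; apply/seteqP; split=> [x Nx|x /sb_center_conjP Zx c].
  apply/sb_center_conjP => y; rewrite -(qproj_repr y).
  have [/qproj_eq L /qproj_eq D /qproj_eq M] := Nx (qrepr y).
  by rewrite -(sb_morph_lambda pM) -(sb_morph_conjD pM) -(sb_morph_conjM pM).
have [L D M] := Zx (qproj N c).
split; apply/qproj_eq.
- by rewrite (sb_morph_lambda pM).
- by rewrite (sb_morph_conjD pM).
- by rewrite (sb_morph_conjM pM).
Qed.

Lemma next_center_sub (N : ideal B) : sub_skew_brace (next_center N).
Proof.
rewrite next_centerE; apply: preimage_sub_brace; first exact: qproj_morph.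
exact: sb_center_sub.
Qed.

Hypotheses (woR : wochoice.well_order R) (hB : Dedekind B).

Lemma ucs_mono a b : R a b -> ucs a `<=` ucs b.
Proof.
move=> Rab x /ucsP[->|[c ltca xc]]; first exact: Ucs0.
by apply/ucsP; right; exists c => //; exact: wo_lt_le_trans Rab.
Qed.

(** In a Dedekind skew brace this suffices for [ucs a] to be an ideal, so that
    the induction can use the quotients by the earlier terms. *)
Lemma ucs_sub a : sub_skew_brace (ucs a).
Proof.
elim/(wo_ind woR): a => a IH; apply: directed_sub; first exact: Ucs0.
have next b : idx_lt R b a -> sub_skew_brace (next_center (ucs b)) /\
    next_center (ucs b) `<=` ucs a.
  move=> ltba; split; first exact: (next_center_sub (Ideal (hB (IH b ltba)))).
  by move=> z zb; apply/ucsP; right; exists b.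
move=> x y /ucsP[->|[b ltb xb]] /ucsP[->|[c ltc yc]].
- by exists [set 0]; split=> //; [exact: sub_set0 | move=> _ ->; exact: Ucs0].
- have [cs cE] := next c ltc.
  by exists (next_center (ucs c)); split=> //; exact: sub0.
- have [bs bE] := next b ltb.
  by exists (next_center (ucs b)); split=> //; exact: sub0.
have [[bs bE] [cs cE]] := (next b ltb, next c ltc).
have [bc|cb] := wo_total woR b c.
  exists (next_center (ucs c)); split=> //.
  exact: (next_center_mono (ucs_mono bc)).
exists (next_center (ucs b)); split=> //.
exact: (next_center_mono (ucs_mono cb)).
Qed.

Definition ucs_ideal a : ideal B := Ideal (hB (ucs_sub a)).

Lemma ucs_next a : ucs a `<=` next_center (ucs a).
Proof.
move=> x xa; rewrite (next_centerE (ucs_ideal a)) /preimage /=.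
move/(@qproj_eq0 _ (ucs_ideal a)): xa => ->.
exact: (sub0 (sb_center_sub _)).
Qed.

Lemma ucs_upper_central : upper_central_series R ucs_ideal.
Proof.
split; first split=> //.
- exact: ucs_mono.
- move=> a a0; apply/seteqP; split=> [x|_ ->]; last exact: Ucs0.
  by move=> /ucsP[//|[b [Rba ba] _]]; case: ba; exact: (wo_anti woR).
- move=> a [/existsNP [b0 /wo_ltNle-/(_ woR) ltb0] asucc].
  apply/seteqP; split=> [x|x [b /= [Rba _]]]; last exact: ucs_mono.
  move=> /ucsP[->|[b ltba xb]]; first by exists b0 => //; exact: Ucs0.
  have /not_andP[//|/existsNP [c /not_implyP [ltbc Rac]]] := asucc b.
  exists c; first exact/(wo_ltNle woR).
  by apply/ucsP; right; exists b.
move=> a b [ltab minb].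
have E : ucs b = next_center (ucs a).
  apply/seteqP; split=> [x /ucsP[->|[c ltcb xc]]|x xa].
  - exact/ucs_next/Ucs0.
  - have Rca : R c a.
      apply: contrapT => /(wo_ltNle woR) /minb.
      exact/(wo_ltNle woR).
    exact: (next_center_mono (ucs_mono Rca)).
  - by apply/ucsP; right; exists a.
apply/seteqP; split=> [_ [x xb <-]|y Zy].
  by move: xb; rewrite /= E (next_centerE (ucs_ideal a)).
exists (qrepr y); last exact: qproj_repr.
by rewrite /= E (next_centerE (ucs_ideal a)) /preimage /= qproj_repr.
Qed.

End Hypercentral.

Lemma no_injection_of_sets (T : Type) (f : set T -> T) : ~ injective f.
Proof.
move=> f_inj; pose D : set T := [set x | exists2 S, x = f S & ~ S x].
have [Df|nDf] := pselect (D (f D)).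
  by have [S E nS] := Df; apply: nS; rewrite -(f_inj _ _ E).
by case: (nDf); exists D.
Qed.

(** If the series never reached [B], it would grow at each index, and choosing a
    new element at each index would inject the power set of [B] into [B]. *)
Lemma tame_hypercentral (B : skewBraceType) :
  Dedekind B -> tame_quotients B -> hypercentral B.
Proof.
move=> hB tB; have [R woR] := wochoice.well_ordering_principle (set B).
exists (set B), R, (ucs_ideal woR hB); split; first exact: ucs_upper_central.
apply: contrapT => /forallNP noT.
have grow a : exists x : B, next_center (ucs R a) x /\ ~ ucs R a x.
  pose N := ucs_ideal woR hB a.
  have [y Ny] : exists y : B, ~ ucs R a y.
    apply: contrapT => /forallNP all; apply: (noT a).
    by apply/seteqP; split=> // x _; apply: contrapT; exact: all.
  have [|c Zc c0] := center_nontrivial (quot_Dedekind (N := N) hB) (quot_tame tB).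
    by exists (qproj N y) => /qproj_eq0.
  exists (qrepr c); split.
    by rewrite (next_centerE N) /preimage /= qproj_repr.
  by move=> /(@qproj_eq0 _ N); rewrite qproj_repr.
have [f fP] := choice grow; apply: (@no_injection_of_sets B f).
have flt a b : idx_lt R a b -> f a <> f b.
  move=> ltab E; have [fa _] := fP a; have [_ fb] := fP b; apply: fb.
  by rewrite -E; apply/ucsP; right; exists a.
move=> a b E; apply: contrapT => ab.
have [Rab|Rba] := wo_total woR a b; first by apply: flt E; split.
by apply: (flt b a _ (esym E)); split=> //; apply/nesym.
Qed.

(** * The theorem *)

Theorem theorem3p5 (B : skewBraceType) (hB : Dedekind B)
    (A : Type) (R : rel A) (I : A -> ideal B)
    (hI : ascending_series R I)
    (hfactor : forall a b : A, idx_succ R a b ->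
       [\/ locally_finite (ideal_factor (I b) (I a)),
           cyclic_subgroup
             (ideal_factor (I b) (I a) : set (addg (quot_brace (I a))))
         | cyclic_subgroup (ideal_factor (I b) (I a) : set (quot_brace (I a)))]) :
  [/\ (forall J : ideal B,
         infinite_cyclic (J : set (addg B)) \/ infinite_cyclic (J : set B) ->
         J `<=` sb_center B),
      hypercentral B
    & (forall X : set B,
         sub_skew_brace X -> trivial_on X -> ~ periodic (X : set (addg B)) ->
         X `<=` sb_center B)].
Proof.
have tB := series_tame_quotients hI hfactor.
split.
- move=> [J Jid] /= [] [/cyclic_subgroupP[g E] Jinf]; rewrite E in Jid Jinf *.
    by apply: add_cyclic_central => // /cyc_finite.
  by apply: circ_cyclic_central => // /cyc_finite.
- exact: tame_hypercentral.
- exact: trivial_nonperiodic_central.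
Qed.
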